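(* The category $\mathsf{Sob}$ is dually equivalent to $\mathsf{TATop}$, and the category $\mathsf{ASob}$ is dually equivalent to $\mathsf{TAApp}$: $\mathsf{Sob}^{\mathrm{op}}\cong\mathsf{TATop}$ and $\mathsf{ASob}^{\mathrm{op}}\cong\mathsf{TAApp}$ (equivalences of categories). Here $\mathsf{Sob}$ (respectively $\mathsf{ASob}$) is the category of sober topological spaces and continuous maps (respectively sober approach spaces and contraction maps), and $\mathsf{TATop}$ (respectively $\mathsf{TAApp}$) is the category of totally algebraic T$_0$ topological (respectively approach) spaces and those continuous (respectively contraction) maps which have both a left and a right adjoint.
   Context: Two parallel cases are treated. Topological case: $\mathsf V=\{\mathrm{false},\mathrm{true}\}=\{0,1\}$, $\otimes=\&$, $k=\mathrm{true}$, $\mathrm{false}\sqsubseteq\mathrm{true}$. Approach case: $\mathsf V=[0,\infty]$, $\otimes=+$, $k=0$, $u\sqsubseteq v$ iff $u\ge v$ numerically (so joins $\bigvee$ in $\mathsf V$ are numerical infima and meets $\bigwedge$ are numerical suprema). A $\mathsf V$-relation $r\colon X\nrightarrow Y$ is a function $X\times Y\to\mathsf V$; composition is $(s\cdot r)(x,z)=\bigvee_y r(x,y)\otimes s(y,z)$; $r^\circ(y,x)=r(x,y)$; $\mathsf V$-relations are ordered pointwise by $\sqsubseteq$; a function is viewed as the $\mathsf V$-relation given by its graph (true $\mapsto k$, false $\mapsto$ bottom of $\mathsf V$). $UX$ is the set of ultrafilters on $X$, $Uf$ the image-ultrafilter map, $e_X(x)$ the principal ultrafilter at $x$, $m_X\colon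 UUX\to UX$, $m_X(\mathfrak X)=\{A\subseteq X\mid A^\#\in\mathfrak X\}$ with $A^\#=\{\mathfrak x\in UX\mid A\in\mathfrak x\}$. For $r\colon X\nrightarrow Y$, $Ur(\mathfrak x,\mathfrak y)=\bigwedge_{A\in\mathfrak x,B\in\mathfrak y}\bigvee_{x\in A,y\in B}r(x,y)$. A space is a pair $(X,a)$ with $a\colon UX\nrightarrow X$, $e_X^\circ\sqsubseteq a$ and $a\cdot Ua\cdot m_X^\circ\sqsubseteq a$; in the topological case these are exactly the topological spaces with their ultrafilter convergence, in the approach case these are the approach spaces. A map $f\colon(X,a)\to(Y,b)$ of spaces is a function with $a(\mathfrak x,x)\sqsubseteq b(Uf(\mathfrak x),f(x))$ (continuous, respectively contraction, map). The categories are $\mathsf{Top}$ and $\mathsf{App}$. Maps are ordered by $f\le g$ iff $k\sqsubseteq b(e_Y(f(x)),g(x))$ for all $x$; $f\cong g$ means $f\le g$ and $g\le f$; $f\dashv g$ means $1\le g\cdot f$ and $f\cdot g\le 1$. The underlying order of $X$ is $x\le y$ iff $k\sqsubseteq a(e_X(x),y)$; $x\cong y$ means $x\le y$ and $y\le x$; $X$ is T$_0$ if this order is anti-symmetric. $X\otimes Y$ is $X\times Y$ with structure $c(\mathfrak w,(x,y))=a(U\pi_1(\mathfrak w),x)\otimes b(U\pi_2(\mathfrak w),y)$. $\mathsf V$ is a space: the Sierpiński space with $\{1\}$ closed, respectively $[0,\infty]$ with $\lambda(\mathfrak u,x)=\max\{x-\xi(\mathfrak u),0\}$ (with $\infty-\infty=0$),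 $\xi(\mathfrak u)=\sup_{A\in\mathfrak u}\inf A$. A $\mathsf U$-relation $r\colon X\rightharpoonup Y$ is a $\mathsf V$-relation $UX\nrightarrow Y$; Kleisli composition is $s\circ r=s\cdot Ur\cdot m_X^\circ$. A $\mathsf U$-module $\varphi\colon(X,a)\rightharpoonup(Y,b)$ is a $\mathsf U$-relation with $\varphi\circ a=\varphi$ and $b\circ\varphi=\varphi$; spaces and $\mathsf U$-modules form an ordered category with identities $a$ (so one can speak of adjoint $\mathsf U$-modules). Each map $f\colon X\to Y$ gives $\mathsf U$-modules $f_*\colon X\rightharpoonup Y$, $f_*(\mathfrak x,y)=b(Uf(\mathfrak x),y)$, and $f^*\colon Y\rightharpoonup X$, $f^*(\mathfrak y,x)=b(\mathfrak y,f(x))$. For $x\in X$, $x^*=a(-,x)\colon X\rightharpoonup 1$, where $1$ is the one-point space. $X^{\mathrm{op}}$ is the space on $UX$ with structure $(\mathfrak X,\mathfrak x)\mapsto(Ua\cdot m_X^\circ)(\mathfrak x,m_X(\mathfrak X))$. $PX$ is the set of $\mathsf U$-modules $\psi\colon X\rightharpoonup 1$ (equivalently, maps $X^{\mathrm{op}}\to\mathsf V$) with the structure of the exponential $\mathsf V^{X^{\mathrm{op}}}$, i.e. the unique one such that for each space $Z$ a function $h\colon Z\to PX$ is a map iff $(z,\mathfrak x)\mapsto h(z)(\mathfrak x)$ is a map $Z\otimes X^{\mathrm{op}}\to\mathsf V$ (this structure exists). The Yoneda embedding is $y_X\colon X\to PX$, $x\mapsto x^*$. $X$ is cocomplete if $y_X$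 has a left adjoint $\mathrm{Sup}_X\colon PX\to X$ in $\mathsf{Top}$/$\mathsf{App}$; a cocomplete $X$ is completely distributive if $\mathrm{Sup}_X$ has a left adjoint $t_X\colon X\to PX$ in $\mathsf{Top}$/$\mathsf{App}$. A completely distributive space $L$ is totally algebraic if $\mathrm{Sup}_L(x^*\circ i_*\circ i^* )\cong x$ for every $x\in L$, where $i\colon A\to L$ is the equaliser of $t_L,y_L\colon L\to PL$ in $\mathsf{Top}$/$\mathsf{App}$. A space $X$ is sober if every right adjoint $\mathsf U$-module $\psi\colon X\rightharpoonup 1$ is of the form $\psi=x^*$ for a unique $x\in X$ (separated and Lawvere complete); for topological spaces this is the usual notion of sobriety, and for approach spaces it is sobriety in the usual sense of approach theory. *)

(* Defs.v *)
From mathcomp Require Import all_boot all_order all_algebra.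
From mathcomp Require Import all_classical.
From mathcomp Require Import reals constructive_ereal ereal.

Set Implicit Arguments.
Unset Strict Implicit.
Unset Printing Implicit Defensive.

Import Order.TTheory GRing.Theory Num.Theory.
Local Open Scope classical_set_scope.

Lemma sval_inj T (P : T -> Prop) (u v : {x | P x}) : sval u = sval v -> u = v.
Proof.
case: u v => [u Pu] [v Pv] /= uv; case: v / uv Pv => Pv.
by congr exist; exact: Prop_irrelevance.
Qed.

Definition U (X : Type) : Type := {F : set_system X | UltraFilter F}.

Lemma U_ultra X (F : U X) : UltraFilter (sval F).
Proof. exact: svalP. Qed.

Lemma U_eq X (F G : U X) : (forall A, sval F A <-> sval G A) -> F = G.
Proof. by move=> h; apply: sval_inj; apply/funext => A; apply/propext. Qed.

Lemma UI X (F : U X) A B : sval F A -> sval F B -> sval F (A `&` B).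
Proof. by case: F => F [[F0 FF] mF] /= FA FB; apply: filterI. Qed.

Lemma US X (F : U X) (A B : set X) : A `<=` B -> sval F A -> sval F B.
Proof. by case: F => F [[F0 FF] mF] /= AB; apply: filterS. Qed.

Lemma U_ex X (F : U X) A : sval F A -> A !=set0.
Proof. by case: F => F [FP mF] /= FA; exact: (@filter_ex _ F FP A FA). Qed.

Lemma ultra_of X (F : set_system X) : ProperFilter F ->
  (forall A, F A \/ F (~` A)) -> UltraFilter F.
Proof.
move=> FP dec; split => // G GP FG; rewrite eqEsubset; split => // A GA.
have [//|/FG GnA] := dec A.
by have /filter_ex [? []] : G (A `&` ~` A) by exact: filterI.
Qed.

Lemma Umap_ultra X Y (f : X -> Y) (F : U X) :
  UltraFilter [set A | sval F (f @^-1` A)].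
Proof.
case: F => F FU /=; apply: ultra_of.
by move=> A; exact: (in_ultra_setVsetC (f @^-1` A) FU).
Qed.

Definition Umap X Y (f : X -> Y) (F : U X) : U Y := exist _ _ (Umap_ultra f F).

Definition Uunit (X : Type) (x : X) : U X :=
  exist _ (principal_filter x) (principal_filter_ultra x).

Definition sharp X (A : set X) : set (U X) := [set F | sval F A].

Lemma Umult_ultra X (FF : U (U X)) : UltraFilter [set A | sval FF (sharp A)].
Proof.
apply: ultra_of.
  split=> /=; last split=> /=.
  - by move=> /U_ex[F /U_ex[]].
  - have {1}-> : sharp [set: X] = setT.
      by apply/seteqP; split=> // F _; case: F => F [[? ?] ?]; exact: filterT.
    by case: FF => FF [[? ?] ?]; exact: filterT.
  - by move=> A B FA FB; apply: US (UI FA FB) => F [FA' FB']; exact: UI.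
  - by move=> A B AB; apply: US => F; exact: US.
move=> A; have [h|h] := in_ultra_setVsetC (sharp A) (U_ultra FF); first by left.
right; apply: US h => F nFA.
by have [/nFA|] := in_ultra_setVsetC A (U_ultra F).
Qed.

Definition Umult X (FF : U (U X)) : U X := exist _ _ (Umult_ultra FF).

Record quantale := Quantale {
  qsort :> Type;
  qle : qsort -> qsort -> Prop;
  qsup : set qsort -> qsort;
  qten : qsort -> qsort -> qsort;
  qk : qsort;
  qle_refl : forall u, qle u u;
  qle_trans : forall v u w, qle u v -> qle v w -> qle u w;
  qle_anti : forall u v, qle u v -> qle v u -> u = v;
  qsup_ub : forall (S : set qsort) u, S u -> qle u (qsup S);
  qsup_le : forall (S : set qsort) v,
    (forall u, S u -> qle u v) -> qle (qsup S) v;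
  qtenA : forall u v w, qten u (qten v w) = qten (qten u v) w;
  qtenC : forall u v, qten u v = qten v u;
  qten1 : forall u, qten qk u = u;
  qten_sup : forall u S, qten u (qsup S) = qsup (qten u @` S)
}.
Arguments qk {q}.

Definition qbot {V : quantale} : V := qsup set0.
Definition qtop {V : quantale} : V := qsup setT.
Definition qinf {V : quantale} (S : set V) : V :=
  qsup [set v | forall u, S u -> qle v u].

Record vsetting := VSetting {
  vquantale :> quantale;
  vcvg : U vquantale -> vquantale -> vquantale
}.

Definition bool_sup (S : set bool) : bool := `[< S true >].

Lemma bool_quantale_ten_sup (u : bool) (S : set bool) :
  u && bool_sup S = bool_sup (andb u @` S).
Proof.
rewrite /bool_sup; case: u => /=; last by apply/esym/asboolPn => -[].
congr asbool; apply/propext; split; first by move=> St; exists true.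
by move=> [[] St].
Qed.

Program Definition bool_quantale : quantale :=
  @Quantale bool (fun u v => u ==> v) bool_sup andb true
    _ _ _ _ _ andbA andbC andTb bool_quantale_ten_sup.
Next Obligation. by case. Qed.
Next Obligation. by case; case; case. Qed.
Next Obligation. by case; case. Qed.
Next Obligation. by move=> S u Su; apply/implyP => ut; apply/asboolP; rewrite -ut. Qed.
Next Obligation. by move=> S v H; apply/implyP => /asboolP /H. Qed.

(* Ultrafilter convergence in the Sierpinski space, whose open sets are
   set0, [set false] and setT. *)
Definition top_setting : vsetting :=
  @VSetting bool_quantale
    (fun F x => `[< x = false -> sval F [set false] >]).

Section Approach.
Variable R : realType.
Local Open Scope ereal_scope.

Definition enn : Type := {x : \bar R | 0 <= x}.

Definition enn_inf (S : set enn) : \bar R := ereal_inf [set sval u | u in S].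

Lemma enn_inf_ge0 S : 0 <= enn_inf S.
Proof. by apply: le_ereal_inf_tmp => _ [u _ <-]; exact: (svalP u). Qed.

Definition enn_sup (S : set enn) : enn := exist _ (enn_inf S) (enn_inf_ge0 S).

Definition enn_add (u v : enn) : enn :=
  exist _ (sval u + sval v) (adde_ge0 (svalP u) (svalP v)).

Definition enn0 : enn := exist _ 0 (lexx 0).

Lemma enn_eq (u v : enn) : sval u = sval v -> u = v.
Proof. by move=> h; apply/val_inj. Qed.

Lemma enn_add_sup u S : enn_add u (enn_sup S) = enn_sup (enn_add u @` S).
Proof.
apply: enn_eq => /=; apply/eqP; rewrite eq_le; apply/andP; split.
  apply: le_ereal_inf_tmp => _ [_ [v Sv <-] <-] /=.
  by apply: leeD2l; apply: ereal_inf_lbound; exists v.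
case: u => -[r| |] //= r0; last first.
  by rewrite addye ?leey // gt_eqF // (lt_le_trans _ (enn_inf_ge0 S)).
rewrite -leeBlDl //; apply: le_ereal_inf_tmp => _ [v Sv <-].
rewrite leeBlDl //; apply: ereal_inf_lbound.
by exists (enn_add (exist _ r%:E r0) v) => //; exists v.
Qed.

Program Definition enn_quantale : quantale :=
  @Quantale enn (fun u v => sval v <= sval u) enn_sup enn_add enn0
    _ _ _ _ _ _ _ _ enn_add_sup.
Next Obligation. by []. Qed.
Next Obligation. by move=> v u w H H0; exact: le_trans H0 H. Qed.
Next Obligation. by move=> u v H H0; apply: enn_eq; apply/eqP; rewrite eq_le H H0. Qed.
Next Obligation. by move=> S u Su; apply: ereal_inf_lbound; exists u. Qed.
Next Obligation. by move=> S v H; apply: le_ereal_inf_tmp => _ [u Su <-]; exact: H. Qed.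
Next Obligation. by move=> u v w; apply: enn_eq; rewrite /= addeA. Qed.
Next Obligation. by move=> u v; apply: enn_eq; rewrite /= addeC. Qed.
Next Obligation. by move=> u; apply: enn_eq; rewrite /= add0e. Qed.

Definition enn_xi (F : U enn) : \bar R :=
  ereal_sup [set enn_inf A | A in sval F].

Lemma enn_cvg_ge0 (F : U enn) (x : enn) : 0 <= maxe (sval x - enn_xi F) 0.
Proof. by rewrite le_max lexx orbT. Qed.

(* cvg is lambda(F, x) = max (x - xi F, 0); in \bar R one has +oo - +oo = -oo, which maxe truncates to 0. *)
Definition app_setting : vsetting :=
  @VSetting enn_quantale
    (fun F x => exist _ (maxe (sval x - enn_xi F) 0) (enn_cvg_ge0 F x)).

End Approach.

Section VRelations.
Variable V : quantale.

Definition vrel (X Y : Type) := X -> Y -> V.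

Definition vrle X Y (r s : vrel X Y) : Prop := forall x y, qle (r x y) (s x y).

Definition vcomp X Y Z (s : vrel Y Z) (r : vrel X Y) : vrel X Z :=
  fun x z => qsup (range (fun y => qten (r x y) (s y z))).

Definition vopp X Y (r : vrel X Y) : vrel Y X := fun y x => r x y.

Definition graph X Y (f : X -> Y) : vrel X Y :=
  fun x y => if pselect (f x = y) then qk else qbot.

Definition Urel X Y (r : vrel X Y) : vrel (U X) (U Y) :=
  fun F G => qinf [set v | exists A B, [/\ sval F A, sval G B &
    v = qsup [set w | exists x y, [/\ A x, B y & w = r x y]]]].

(* U-relations from X to Y are V-relations from U X to Y. *)
Definition kleisli X Y Z (s : vrel (U Y) Z) (r : vrel (U X) Y) :
    vrel (U X) Z :=
  vcomp (vcomp s (Urel r)) (vopp (graph (@Umult X))).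

(* Notions that make sense for any convergence relation are stated for
   prespaces, so that X^op, tensor products, V and P X, although spaces, need
   not be packaged with the proofs of the two axioms of is_space. *)
Record prespace := Prespace {
  point :> Type;
  cvg : vrel (U point) point
}.

Definition is_space (X : prespace) : Prop :=
  vrle (vopp (graph (@Uunit X))) (@cvg X) /\
  vrle (vcomp (vcomp (@cvg X) (Urel (@cvg X))) (vopp (graph (@Umult X))))
       (@cvg X).

Record space := Space { prespace_of :> prespace; spaceP : is_space prespace_of }.

Definition is_map (X Y : prespace) (f : X -> Y) : Prop :=
  forall F x, qle (cvg F x) (cvg (Umap f F) (f x)).

Definition ple (X : prespace) (x y : X) : Prop := qle qk (cvg (Uunit x) y).

Definition pequiv (X : prespace) (x y : X) : Prop := ple x y /\ ple y x.

Definition T0 (X : prespace) : Prop := forall x y : X, ple x y -> ple y x -> x = y.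

Definition mle (X Y : prespace) (f g : X -> Y) : Prop := forall x, ple (f x) (g x).

(* f -| g: the first argument is the left adjoint. *)
Definition adjoint (X Y : prespace) (f : X -> Y) (g : Y -> X) : Prop :=
  [/\ is_map f, is_map g, mle (fun x => x) (fun x => g (f x)) &
      mle (fun y => f (g y)) (fun y => y)].

Definition tensor (X Y : prespace) : prespace :=
  @Prespace (X * Y)%type
    (fun W p => qten (cvg (Umap fst W) p.1) (cvg (Umap snd W) p.2)).

(* In both settings k is the top of V, so this is the only space structure on a
   one-point set. *)
Definition one : prespace := @Prespace unit (fun _ _ => qk).

Definition is_module (X Y : prespace) (phi : vrel (U X) Y) : Prop :=
  kleisli phi (@cvg X) = phi /\ kleisli (@cvg Y) phi = phi.

(* Adjunction phi -| psi in the ordered category of spaces and modules. *)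
Definition module_adjoint (X Y : prespace)
    (phi : vrel (U X) Y) (psi : vrel (U Y) X) : Prop :=
  [/\ is_module phi, is_module psi,
      vrle (@cvg X) (kleisli psi phi) & vrle (kleisli phi psi) (@cvg Y)].

Definition lower_star (X Y : prespace) (f : X -> Y) : vrel (U X) Y :=
  fun F y => cvg (Umap f F) y.

Definition upper_star (X Y : prespace) (f : X -> Y) : vrel (U Y) X :=
  fun G x => cvg G (f x).

Definition point_star (X : prespace) (x : X) : vrel (U X) one :=
  fun F _ => cvg F x.

Definition sober (X : prespace) : Prop :=
  forall psi : vrel (U X) one, is_module psi ->
    (exists phi : vrel (U one) X, module_adjoint phi psi) ->
    exists! x : X, psi = point_star x.

Definition op (X : prespace) : prespace :=
  @Prespace (U X)
    (fun FF F => vcomp (Urel (@cvg X)) (vopp (graph (@Umult X))) F (Umult FF)).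

Definition is_equaliser (A X Y : prespace) (i : A -> X) (f g : X -> Y) : Prop :=
  [/\ is_map i, (forall a, f (i a) = g (i a)) &
      forall (Z : space) (h : Z -> X), is_map h -> (forall z, f (h z) = g (h z)) ->
        exists! h' : Z -> A, is_map h' /\ (forall z, i (h' z) = h z)].

Lemma vcompE_le X Y Z (s : vrel Y Z) (r : vrel X Y) x y z :
  qle (qten (r x y) (s y z)) (vcomp s r x z).
Proof. by apply: qsup_ub; exists y. Qed.

Lemma vcomp_le X Y Z (s : vrel Y Z) (r : vrel X Y) x z v :
  (forall y, qle (qten (r x y) (s y z)) v) -> qle (vcomp s r x z) v.
Proof. by move=> h; apply: qsup_le => _ [y _ <-]; exact: h. Qed.

Lemma qbot_le (v : V) : qle qbot v.
Proof. by apply: qsup_le. Qed.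

Lemma qtenbot (v : V) : qten qbot v = qbot.
Proof. by rewrite qtenC /qbot qten_sup image_set0. Qed.

Lemma qten_le (u v w : V) : qle v w -> qle (qten u v) (qten u w).
Proof.
move=> vw; have -> : w = qsup [set v; w].
  apply: qle_anti; first by apply: qsup_ub; right.
  by apply: qsup_le => _ [->//|->]; exact: qle_refl.
by rewrite qten_sup; apply: qsup_ub; exists v => //; left.
Qed.

Lemma qinf_lb (S : set V) u : S u -> qle (qinf S) u.
Proof. by move=> Su; apply: qsup_le => v; exact. Qed.

Lemma qinf_ge (S : set V) v : (forall u, S u -> qle v u) -> qle v (qinf S).
Proof. by move=> h; apply: qsup_ub. Qed.

Lemma graph_refl X Y (f : X -> Y) x : graph f x (f x) = qk.
Proof. by rewrite /graph; case: pselect. Qed.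

Lemma kleisli_le X Y Z (s : vrel (U Y) Z) (r : vrel (U X) Y) F z v :
  (forall FF G, Umult FF = F -> qle (qten (Urel r FF G) (s G z)) v) ->
  qle (kleisli s r F z) v.
Proof.
move=> h; apply: vcomp_le => FF; rewrite /vopp /graph; case: pselect => e.
  by rewrite qten1; apply: vcomp_le => G; exact: h.
by rewrite qtenbot; exact: qbot_le.
Qed.

Lemma kleisli_ge X Y Z (s : vrel (U Y) Z) (r : vrel (U X) Y) FF G z :
  qle (qten (Urel r FF G) (s G z)) (kleisli s r (Umult FF) z).
Proof.
apply: qle_trans (vcompE_le _ _ _ FF _).
by rewrite /vopp graph_refl qten1; exact: vcompE_le.
Qed.

Lemma cvg_refl (X : space) (x : X) : qle qk (cvg (Uunit x) x).
Proof. by have [/(_ (Uunit x) x)] := spaceP X; rewrite /vopp graph_refl. Qed.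

Lemma cvg_trans (X : space) (FF : U (U X)) G (x : X) :
  qle (qten (Urel (@cvg X) FF G) (cvg G x)) (cvg (Umult FF) x).
Proof.
by have [_ h] := spaceP X; apply: qle_trans (kleisli_ge _ _ _ _ _) (h _ _).
Qed.

Lemma Umult_unit X (F : U X) : Umult (Uunit F) = F.
Proof. by apply: U_eq => A; rewrite /= /sharp principal_filterP. Qed.

Lemma Umult_map_unit X (F : U X) : Umult (Umap (@Uunit X) F) = F.
Proof.
apply: U_eq => A /=.
suff -> : @Uunit X @^-1` sharp A = A by [].
by apply/seteqP; split=> x /=; rewrite /sharp /= principal_filterP.
Qed.

Lemma Umap_unit X Y (f : X -> Y) x : Umap f (Uunit x) = Uunit (f x).
Proof. by apply: U_eq => A /=; rewrite !principal_filterP. Qed.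

Lemma Umap_comp X Y Z (g : Y -> Z) (f : X -> Y) F :
  Umap g (Umap f F) = Umap (fun x => g (f x)) F.
Proof. exact: U_eq. Qed.

Lemma Umap_id X (F : U X) : Umap (fun x => x) F = F.
Proof. exact: U_eq. Qed.

Lemma Urel_ge X Y (r : vrel X Y) F G v :
  (forall A B, sval F A -> sval G B ->
     exists x y, [/\ A x, B y & qle v (r x y)]) -> qle v (Urel r F G).
Proof.
move=> h; apply: qinf_ge => _ [A [B [FA GB ->]]].
have [x [y [Ax By vr]]] := h A B FA GB.
by apply: qle_trans vr _; apply: qsup_ub; exists x, y.
Qed.

Lemma point_star_module (X : space) (x : X) : is_module (point_star x).
Proof.
split; apply/funext => F; apply/funext => -[]; apply: qle_anti.
- by apply: kleisli_le => FF G <-; exact: cvg_trans.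
- rewrite -{2}(Umult_map_unit F); apply: qle_trans (kleisli_ge _ _ _ F _).
  rewrite /point_star -{1}(qten1 (cvg F x)) !(qtenC _ (cvg F x)).
  apply: qten_le; apply: Urel_ge => A B /= FA FB.
  have [y [Ay By]] := U_ex (UI FA FB).
  by exists (Uunit y), y; split=> //; exact: cvg_refl.
- apply: kleisli_le => FF G <- /=; rewrite qtenC qten1.
  apply: (@qle_trans _ (qten (Urel (@cvg X) FF (Uunit x)) (cvg (Uunit x) x)));
    last exact: cvg_trans.
  apply: (@qle_trans _ (Urel (@cvg X) FF (Uunit x))); last first.
    by rewrite -{1}(qten1 (Urel _ _ _)) !(qtenC _ (Urel _ _ _));
       apply: qten_le; exact: cvg_refl.
  apply: qinf_ge => _ [A [B [FA /principal_filterP Bx ->]]].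
  apply: (@qle_trans _ (qsup [set w | exists H y,
     [/\ A H, setT y & w = point_star x H y]])).
    apply: qinf_lb; exists A, setT; split=> //.
    by case: G => G [[? ?] ?]; exact: filterT.
  by apply: qsup_le => _ [H [y [AH _ ->]]]; apply: qsup_ub; exists H, x.
- rewrite -{2}(Umult_unit F).
  apply: qle_trans (kleisli_ge _ _ _ (Uunit tt) _) => /=; rewrite qtenC qten1.
  apply: Urel_ge => A B /principal_filterP AF /principal_filterP Bt.
  by exists F, tt; split=> //; exact: qle_refl.
Qed.

Lemma ple_trans (X : space) (y x z : X) : ple x y -> ple y z -> ple x z.
Proof.
move=> xy yz; rewrite /ple -(Umult_unit (Uunit x)).
apply: qle_trans (cvg_trans _ (Uunit y) _).
apply: (@qle_trans _ (qten qk (cvg (Uunit y) z))); first by rewrite qten1.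
rewrite !(qtenC _ (cvg _ z)); apply: qten_le.
apply: Urel_ge => A B /principal_filterP Ax /principal_filterP By.
by exists (Uunit x), y.
Qed.

Lemma is_map_id (X : prespace) : is_map (fun x : X => x).
Proof. by move=> F x; rewrite Umap_id; exact: qle_refl. Qed.

Lemma is_map_comp (X Y Z : prespace) (g : Y -> Z) (f : X -> Y) :
  is_map g -> is_map f -> is_map (fun x => g (f x)).
Proof.
by move=> mg mf F x; rewrite -Umap_comp; apply: qle_trans (mf _ _) (mg _ _).
Qed.

Lemma is_map_ple (X Y : prespace) (f : X -> Y) x y :
  is_map f -> ple x y -> ple (f x) (f y).
Proof. by move=> mf xy; rewrite /ple -Umap_unit; exact: qle_trans xy (mf _ _). Qed.

Lemma adjoint_id (X : space) : adjoint (fun x : X => x) (fun x : X => x).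
Proof. by split; [exact: is_map_id|exact: is_map_id|exact: cvg_refl..]. Qed.

Lemma adjoint_comp (X Y Z : space) (f : X -> Y) (g : Y -> X)
    (f' : Y -> Z) (g' : Z -> Y) :
  adjoint f g -> adjoint f' g' ->
  adjoint (fun x => f' (f x)) (fun z => g (g' z)).
Proof.
move=> [mf mg u v] [mf' mg' u' v']; split; [exact: is_map_comp..| |].
- by move=> x; apply: ple_trans (u x) _; apply: is_map_ple (u' _).
- by move=> z; apply: ple_trans (v' z); apply: is_map_ple (v _).
Qed.

End VRelations.

Section Presheaves.
Variable V : vsetting.

Definition Vspace : prespace V := @Prespace V V (@vcvg V).

Definition presheaf (X : prespace V) : Type :=
  {psi : vrel V (U X) (one V) | is_module psi}.

Definition is_exponential (X : prespace V)
    (c : vrel V (U (presheaf X)) (presheaf X)) : Prop :=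
  is_space (Prespace c) /\
  forall (Z : space V) (h : Z -> presheaf X),
    @is_map V Z (Prespace c) h <->
    @is_map V (tensor Z (op X)) Vspace (fun p => sval (h p.1) p.2 tt).

(* The exponential structure exists and is unique; the else branch only makes
   the definition total without a proof of existence. *)
Definition presheaf_cvg (X : prespace V) :
    vrel V (U (presheaf X)) (presheaf X) :=
  if pselect (exists c, is_exponential (X := X) c) is left h
  then projT1 (cid h) else fun _ _ => qtop.

Definition P (X : space V) : prespace V := Prespace (@presheaf_cvg X).

Definition yoneda (X : space V) (x : X) : P X :=
  exist _ (point_star x) (point_star_module x).

Definition cocomplete (X : space V) : Prop :=
  exists Sup : P X -> X, adjoint Sup (@yoneda X).

Definition completely_distributive (X : space V) : Prop :=
  exists2 Sup : P X -> X, adjoint Sup (@yoneda X) &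
  exists t : X -> P X, adjoint t Sup.

(* The composite x^* o i_* o i^* is a module, since composition of modules is
   one; psi is that module regarded as a point of P L. *)
Definition totally_algebraic (L : space V) : Prop :=
  completely_distributive L /\
  forall (Sup : P L -> L) (t : L -> P L),
    adjoint Sup (@yoneda L) -> adjoint t Sup ->
  forall (A : space V) (i : A -> L), is_equaliser i t (@yoneda L) ->
  forall x : L, exists psi : P L,
    sval psi = kleisli (point_star x) (kleisli (lower_star i) (upper_star i)) /\
    pequiv (Sup psi) x.

End Presheaves.

Record category := Category {
  ob :> Type;
  hom : ob -> ob -> Type;
  idm : forall A, hom A A;
  cmp : forall A B C, hom B C -> hom A B -> hom A C;
  cmp1m : forall A B (f : hom A B), cmp (idm B) f = f;
  cmpm1 : forall A B (f : hom A B), cmp f (idm A) = f;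
  cmpA : forall A B C D (h : hom C D) (g : hom B C) (f : hom A B),
    cmp h (cmp g f) = cmp (cmp h g) f
}.
Arguments hom {c}.
Arguments idm {c}.

Definition opposite (C : category) : category :=
  @Category C (fun A B => hom B A) (@idm C) (fun _ _ _ g f => cmp f g)
    (fun _ _ f => cmpm1 f) (fun _ _ f => cmp1m f)
    (fun _ _ _ _ h g f => esym (cmpA f g h)).

Record functor (C D : category) := Functor {
  fob :> C -> D;
  fmor : forall A B, hom A B -> hom (fob A) (fob B);
  fmor1 : forall A, fmor (idm A) = idm (fob A);
  fmorM : forall A B E (g : hom B E) (f : hom A B),
    fmor (cmp g f) = cmp (fmor g) (fmor f)
}.

Definition functor_id (C : category) : functor C C :=
  @Functor C C (fun A => A) (fun _ _ f => f) (fun _ => erefl)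
    (fun _ _ _ _ _ => erefl).

Program Definition functor_comp (C D E : category)
    (G : functor D E) (F : functor C D) : functor C E :=
  @Functor C E (fun A => G (F A)) (fun _ _ f => fmor G (fmor F f)) _ _.
Next Obligation. by move=> * /=; rewrite !fmor1. Qed.
Next Obligation. by move=> * /=; rewrite !fmorM. Qed.

Definition is_iso (C : category) (A B : C) (f : hom A B) : Prop :=
  exists g : hom B A, cmp g f = idm A /\ cmp f g = idm B.

Definition naturally_isomorphic (C D : category) (F G : functor C D) : Prop :=
  exists2 eta : forall A : C, hom (F A) (G A),
    (forall A, is_iso (eta A)) &
    forall (A B : C) (f : hom A B), cmp (eta B) (fmor F f) = cmp (fmor G f) (eta A).

Definition equivalent (C D : category) : Prop :=
  exists (F : functor C D) (G : functor D C),
    naturally_isomorphic (functor_comp G F) (functor_id C) /\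
    naturally_isomorphic (functor_comp F G) (functor_id D).

Section Cats.
Variable V : vsetting.

Definition sober_space : Type := {X : space V | sober X}.

Definition sober_hom (X Y : sober_space) : Type :=
  {f : sval X -> sval Y | is_map f}.

Program Definition Sober : category :=
  @Category sober_space sober_hom
    (fun X => exist _ (fun x => x) (@is_map_id _ _))
    (fun X Y Z g f => exist _ (fun x => sval g (sval f x))
       (is_map_comp (svalP g) (svalP f))) _ _ _.
Next Obligation. by move=> *; exact: sval_inj. Qed.
Next Obligation. by move=> *; exact: sval_inj. Qed.
Next Obligation. by move=> *; exact: sval_inj. Qed.

Definition ta_space : Type := {L : space V | totally_algebraic L /\ T0 L}.

Definition has_adjoints (X Y : space V) (f : X -> Y) : Prop :=
  (exists g : Y -> X, adjoint g f) /\ (exists g : Y -> X, adjoint f g).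

Definition ta_hom (X Y : ta_space) : Type :=
  {f : sval X -> sval Y | is_map f /\ has_adjoints f}.

Lemma ta_id (X : space V) :
  is_map (fun x : X => x) /\ has_adjoints (fun x : X => x).
Proof.
split; first exact: is_map_id.
by split; exists (fun x => x); exact: adjoint_id.
Qed.

Lemma ta_comp (X Y Z : space V) (g : Y -> Z) (f : X -> Y) :
  is_map g /\ has_adjoints g -> is_map f /\ has_adjoints f ->
  is_map (fun x => g (f x)) /\ has_adjoints (fun x => g (f x)).
Proof.
move=> [mg [[lg Lg] [rg Rg]]] [mf [[lf Lf] [rf Rf]]].
split; first exact: is_map_comp.
split; first by exists (fun z => lf (lg z)); exact: (adjoint_comp Lg Lf).
by exists (fun z => rf (rg z)); exact: (adjoint_comp Rf Rg).
Qed.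

Program Definition TotAlg : category :=
  @Category ta_space ta_hom
    (fun X => exist _ (fun x => x) (@ta_id (sval X)))
    (fun X Y Z g f => exist _ (fun x => sval g (sval f x))
       (ta_comp (svalP g) (svalP f))) _ _ _.
Next Obligation. by move=> *; exact: sval_inj. Qed.
Next Obligation. by move=> *; exact: sval_inj. Qed.
Next Obligation. by move=> *; exact: sval_inj. Qed.

End Cats.

Definition Sob : category := Sober top_setting.
Definition TATop : category := TotAlg top_setting.
Definition ASob (R : realType) : category := Sober (app_setting R).
Definition TAApp (R : realType) : category := TotAlg (app_setting R).

(* Main.v *)
(* The equivalence sends a sober space X to P X and a map h : X -> Y to
   composition with h_*, P Y -> P X. Left adjoint maps P Y -> P X are exactly the
   compositions with modules phi : X -> Y, and such a map has a further left
   adjoint iff phi is a left adjoint module; if Y is sober this means phi = h_*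
   for a unique map h, so the functor is fully faithful. Conversely, for a
   totally algebraic T0 space L with t -| Sup -| y and equaliser i : A -> L of
   t and y, the maps x |-> x^* i_* and psi |-> Sup (psi i^* ) are inverse to each
   other, so L is P A, and A is sober because t x = x^* holds for every x coming
   from a right adjoint module on A.

   Both settings are treated at once: composition of modules is associative as
   soon as V is completely distributive and its ultrafilter limits are
   compatible with the tensor. *)
From mathcomp Require Import all_boot all_order all_algebra.
From mathcomp Require Import all_classical.
From mathcomp Require Import reals constructive_ereal ereal.
Require Import Defs.

Set Implicit Arguments.
Unset Strict Implicit.
Unset Printing Implicit Defensive.

Import Order.TTheory GRing.Theory Num.Theory.
Local Open Scope classical_set_scope.

(** * Ultrafilters *)

Lemma U_sub_eq X (F G : U X) : (forall A, sval F A -> sval G A) -> F = G.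
Proof.
move=> FG; apply: U_eq => A; split=> [|GA]; first exact: FG.
have [//|/FG GnA] := in_ultra_setVsetC A (U_ultra F).
by have [x []] := U_ex (UI GA GnA).
Qed.

Lemma UT X (F : U X) : sval F setT.
Proof. by case: F => F [[? ?] ?]; exact: filterT. Qed.

Lemma U_extend T (S : set (set T)) : S !=set0 ->
  (forall D D', S D -> S D' -> exists2 D'', S D'' & D'' `<=` D `&` D') ->
  (forall D, S D -> D !=set0) ->
  exists W : U T, forall D, S D -> sval W D.
Proof.
move=> S0 SI Sn; have FF : Filter (filter_from S id) by exact: filter_from_filter.
have FP : ProperFilter (filter_from S id) by exact: filter_from_proper.
have [W [WU SW]] := ultraFilterLemma FP.
by exists (exist _ W WU) => D SD; apply: SW; exists D.
Qed.

(** The sets [E ∩ f⁻¹(A) ∩ g⁻¹(B)] form a filter base; any ultrafilter refining it has images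
    containing [F] and [G], hence equal to them by maximality. This is the source of all couplings
    of ultrafilters below. *)
Lemma U_lift T X Y (f : T -> X) (g : T -> Y) (E : set T) (F : U X) (G : U Y) :
  (forall A B, sval F A -> sval G B -> exists t, [/\ E t, A (f t) & B (g t)]) ->
  exists W : U T, [/\ Umap f W = F, Umap g W = G & sval W E].
Proof.
move=> h.
have [W HW] : exists W : U T, forall D, [set E `&` f @^-1` p.1 `&` g @^-1` p.2 |
    p in [set p | sval F p.1 /\ sval G p.2]] D -> sval W D.
  apply: U_extend.
  - by exists (E `&` f @^-1` setT `&` g @^-1` setT); exists (setT, setT) => //=;
      split; exact: UT.
  - move=> _ _ [[A B] /= [FA GB] <-] [[A' B'] /= [FA' GB'] <-].
    exists (E `&` f @^-1` (A `&` A') `&` g @^-1` (B `&` B')).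
      by exists (A `&` A', B `&` B') => //=; split; exact: UI.
    by move=> t [[Et [? ?]] [? ?]].
  - move=> _ [[A B] /= [FA GB] <-]; have [t [Et At Bt]] := h _ _ FA GB.
    by exists t.
exists W; split.
- apply/esym/U_sub_eq => A FA; apply: US (HW _ (ex_intro2 _ _ (A, setT) _ erefl)).
    by move=> t [[]].
  by split=> //; exact: UT.
- apply/esym/U_sub_eq => A FA; apply: US (HW _ (ex_intro2 _ _ (setT, A) _ erefl)).
    by move=> t [[]].
  by split=> //; exact: UT.
- apply: US (HW _ (ex_intro2 _ _ (setT, setT) _ erefl)); first by move=> t [[]].
  by split=> //; exact: UT.
Qed.

Lemma Umult_map X Y (f : X -> Y) (FF : U (U X)) :
  Umult (Umap (Umap f) FF) = Umap f (Umult FF).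
Proof. exact: U_eq. Qed.

Lemma Umult_mult X (F : U (U (U X))) : Umult (Umap (@Umult X) F) = Umult (Umult F).
Proof. exact: U_eq. Qed.

(** * Relations valued in a quantale *)

Local Notation "u ⊑ v" := (qle u v) (at level 70, no associativity).
Local Notation "u ⊗ v" := (qten u v) (at level 40, left associativity).
Local Notation "s ∘ r" := (kleisli s r) (at level 40, left associativity).

Section Quantale.
Variable V : quantale.
Implicit Types u v w : V.

Lemma qten_mono u u' v v' : u ⊑ u' -> v ⊑ v' -> u ⊗ v ⊑ u' ⊗ v'.
Proof.
move=> uu vv; apply: (@qle_trans _ (u ⊗ v')); first exact: qten_le.
by rewrite !(qtenC _ v'); exact: qten_le.
Qed.

Lemma qtenk u : u ⊗ qk = u.
Proof. by rewrite qtenC qten1. Qed.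

Lemma qle_tenk u v : qk ⊑ v -> u ⊑ u ⊗ v.
Proof. by move=> kv; rewrite -{1}(qtenk u); exact: qten_le. Qed.

Lemma qle_kten u v : qk ⊑ v -> u ⊑ v ⊗ u.
Proof. by rewrite qtenC; exact: qle_tenk. Qed.

Lemma qten_sup_le u S v : (forall w, S w -> u ⊗ w ⊑ v) -> u ⊗ qsup S ⊑ v.
Proof. by move=> h; rewrite qten_sup; apply: qsup_le => _ [w Sw <-]; exact: h. Qed.

(** The totally-below relation: complete distributivity means that each [v] is the join of the
    elements totally below it. *)
Definition tbelow u v : Prop :=
  forall S : set V, v ⊑ qsup S -> exists2 s, S s & u ⊑ s.

(** The limit of an ultrafilter in [V], by which [V] is an algebra for the ultrafilter monad;
    numerically, in the approach case, it is the supremum of the infima of the sets in [F]. *)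
Definition xi (F : U V) : V := qinf [set qsup A | A in sval F].

Lemma vrel_anti X Y (r s : vrel V X Y) : vrle r s -> vrle s r -> r = s.
Proof.
by move=> rs sr; apply/funext => x; apply/funext => y; exact: qle_anti.
Qed.

Lemma vcompA W X Y Z (t : vrel V Y Z) (s : vrel V X Y) (r : vrel V W X) :
  vcomp t (vcomp s r) = vcomp (vcomp t s) r.
Proof.
apply: vrel_anti => w z.
- apply: vcomp_le => y; rewrite qtenC; apply: qten_sup_le => _ [x _ <-].
  rewrite qtenC -qtenA; apply: qle_trans (vcompE_le _ _ _ x _).
  by apply: qten_le; exact: vcompE_le.
- apply: vcomp_le => x; apply: qten_sup_le => _ [y _ <-].
  rewrite qtenA; apply: qle_trans (vcompE_le _ _ _ y _).
  by apply: qten_mono; [exact: vcompE_le|exact: qle_refl].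
Qed.

Lemma vcomp_graph (X Y Z : Type) (f : X -> Y) (g : Y -> Z) :
  vcomp (vopp (graph V f)) (vopp (graph V g)) =
  vopp (graph V (fun x => g (f x))).
Proof.
apply: vrel_anti => z x; last first.
  apply: qle_trans (vcompE_le _ _ _ (f x) _).
  rewrite /vopp graph_refl qtenk /graph.
  exact: qle_refl.
apply: vcomp_le => y; rewrite /vopp {2}/graph; case: pselect => [/= <-|h].
  rewrite qtenk {1}/graph; case: pselect => [/= <-|h]; last exact: qbot_le.
  by rewrite graph_refl; exact: qle_refl.
by rewrite qtenC qtenbot; exact: qbot_le.
Qed.

Lemma UrelE_le X Y (r : vrel V X Y) F G A B : sval F A -> sval G B ->
  Urel r F G ⊑ qsup [set w | exists x y, [/\ A x, B y & w = r x y]].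
Proof. by move=> FA GB; apply: qinf_lb; exists A, B. Qed.

Lemma Urel_mono X Y (r s : vrel V X Y) : vrle r s -> vrle (Urel r) (Urel s).
Proof.
move=> rs F G; apply: qinf_ge => _ [A [B [FA GB ->]]].
apply: qle_trans (UrelE_le _ FA GB) _; apply: qsup_le => _ [x [y [Ax By ->]]].
by apply: qle_trans (rs _ _) _; apply: qsup_ub; exists x, y.
Qed.

Lemma Urel_unit X Y (r : vrel V X Y) x y : Urel r (Uunit x) (Uunit y) = r x y.
Proof.
apply: qle_anti.
  have Fx : sval (Uunit x) [set x] by apply/principal_filterP.
  have Gy : sval (Uunit y) [set y] by apply/principal_filterP.
  apply: qle_trans (UrelE_le _ Fx Gy) _.
  by apply: qsup_le => _ [_ [_ [-> -> ->]]]; exact: qle_refl.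
apply: Urel_ge => A B /principal_filterP Ax /principal_filterP By.
by exists x, y; split=> //; exact: qle_refl.
Qed.

Lemma Urel_map (T X Y : Type) (r : vrel V X Y) (f : T -> X) (g : T -> Y) (F : U T) :
  (forall t, qk ⊑ r (f t) (g t)) -> qk ⊑ Urel r (Umap f F) (Umap g F).
Proof.
move=> h; apply: Urel_ge => A B /= FA FB.
by have [t [At Bt]] := U_ex (UI FA FB); exists (f t), (g t).
Qed.

Lemma Urel_preim X Y X' Y' (r : vrel V X Y) (f : X' -> X) (g : Y' -> Y) F G :
  Urel (fun x y => r (f x) (g y)) F G = Urel r (Umap f F) (Umap g G).
Proof.
apply: qle_anti; apply: qinf_ge => _ [A [B [FA GB ->]]].
  apply: qle_trans (UrelE_le _ (FA : sval F (f @^-1` A)) (GB : sval G (g @^-1` B))) _.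
  apply: qsup_le => _ [x [y [Ax By ->]]].
  by apply: qsup_ub; exists (f x), (g y).
have FA' : sval (Umap f F) (f @` A) by apply: US FA => x Ax; exists x.
have GB' : sval (Umap g G) (g @` B) by apply: US GB => x Ax; exists x.
apply: qle_trans (UrelE_le _ FA' GB') _.
apply: qsup_le => _ [_ [_ [[x Ax <-] [y By <-] ->]]].
by apply: qsup_ub; exists x, y.
Qed.

Lemma Urel_graph (X Y : Type) (f : X -> Y) :
  Urel (vopp (graph V f)) = vopp (graph V (Umap f)).
Proof.
apply: vrel_anti => G F; rewrite [vopp (graph V (Umap f)) _ _]/vopp
  [graph V (Umap f) _ _]/graph; case: pselect => [h|h] /=.
- apply: qle_trans (UrelE_le _ (UT G) (UT F)) _.
  apply: qsup_le => _ [y [x [_ _ ->]]]; rewrite /vopp /graph.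
  by case: pselect => _ /=; [exact: qle_refl|exact: qbot_le].
(* Otherwise the preimage of every set of [G] would lie in [F], and [G] would be the image of [F].
   On the pair made of the complement of [f(A)] and [A], the converse graph is constantly bottom. *)
- have [A [FA nGA]] : exists A, sval F A /\ sval G (~` (f @` A)).
    apply/not_existsP => nA; apply: h; apply/esym/U_sub_eq => B GB.
    have [//|FnB] := in_ultra_setVsetC (f @^-1` B) (U_ultra F).
    exfalso; apply: (nA (f @^-1` (~` B))); split=> //.
    by apply: US GB => y By [x nB xy]; apply: nB; rewrite xy.
  apply: qle_trans (UrelE_le _ nGA FA) _; apply: qsup_le => _ [y [x [ny Ax ->]]].
  rewrite /vopp /graph; case: pselect => [xy|_] /=; last exact: qle_refl.
  by exfalso; apply: ny; exists x.
- rewrite -h -{2}(Umap_id F); apply: Urel_map => x.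
  by rewrite /vopp graph_refl; exact: qle_refl.
- exact: qbot_le.
Qed.

End Quantale.

(** * Associativity of Kleisli composition *)

(* The properties shared by the two settings: [V] is completely distributive, and
   its convergence is the internal hom out of the limit [xi], which makes [V]
   a compact algebra compatible with the tensor. *)
Record ultra_setting (V : vsetting) : Prop := UltraSetting {
  below_le : forall v w : V, (forall u, tbelow u v -> u ⊑ w) -> v ⊑ w;
  xi_ten : forall T (W : U T) (f g : T -> V),
    xi (Umap (fun t => f t ⊗ g t) W) ⊑ xi (Umap f W) ⊗ xi (Umap g W);
  vcvgP : forall (F : U V) (v w : V), w ⊑ vcvg F v <-> w ⊗ xi F ⊑ v
}.

Section Setting.
Variables (V : vsetting) (HV : ultra_setting V).

Lemma ten_below_le (u v w : V) : (forall v', tbelow v' v -> u ⊗ v' ⊑ w) -> u ⊗ v ⊑ w.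
Proof.
move=> h; apply: (@qle_trans _ (u ⊗ qsup [set v' | tbelow v' v])).
  by apply: qten_le; apply: (below_le HV) => v' v'v; apply: qsup_ub.
exact: qten_sup_le.
Qed.

(** An ultrafilter [W] couples its two images, and the limit of [r] along the coupling is a lower
    bound for [Urel r]. [Urel_witness] provides couplings that come arbitrarily close to this
    value. *)
Lemma xi_le_Urel T X Y (f : T -> X) (g : T -> Y) (r : vrel V X Y) W :
  xi (Umap (fun t => r (f t) (g t)) W) ⊑ Urel r (Umap f W) (Umap g W).
Proof.
apply: qinf_ge => _ [A [B [/= FA GB ->]]].
apply: (@qle_trans _ (qsup ((fun t => r (f t) (g t)) @` (f @^-1` A `&` g @^-1` B)))).
  apply: qinf_lb; exists ((fun t => r (f t) (g t)) @` (f @^-1` A `&` g @^-1` B)) => //.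
  by apply: US (UI FA GB) => t At; exists t.
by apply: qsup_le => _ [t [At Bt] <-]; apply: qsup_ub; exists (f t), (g t).
Qed.

Lemma xi_ge T (W : U T) (f : T -> V) u : sval W [set t | u ⊑ f t] -> u ⊑ xi (Umap f W).
Proof.
move=> h; apply: qinf_ge => _ [A /= WA <-]; have [t [ut At]] := U_ex (UI h WA).
by apply: qle_trans ut _; exact: qsup_ub.
Qed.

Lemma Urel_witness X Y (r : vrel V X Y) F G u : tbelow u (Urel r F G) ->
  exists W : U (X * Y), [/\ Umap fst W = F, Umap snd W = G &
    sval W [set p | u ⊑ r p.1 p.2]].
Proof.
move=> h; apply: U_lift => A B FA GB.
have [_ [x [y [Ax By ->]]] ur] := h _ (UrelE_le r FA GB).
by exists (x, y).
Qed.

(** Both halves approximate from totally below. For [⊑], an ultrafilter on triples is built and its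
    middle projection is the intermediate ultrafilter; [⊒] intersects two sets of intermediate
    points. *)
Lemma Urel_comp X Y Z (s : vrel V Y Z) (r : vrel V X Y) :
  Urel (vcomp s r) = vcomp (Urel s) (Urel r).
Proof.
apply: vrel_anti => F H.
- apply: (below_le HV) => u hu.
  have [W [WF WH WE]] : exists W : U (X * Y * Z), [/\ Umap (fun t => t.1.1) W = F,
      Umap snd W = H & sval W [set t | u ⊑ r t.1.1 t.1.2 ⊗ s t.1.2 t.2]].
    apply: U_lift => A C FA HC.
    have [|_ [x [y [z [Ax Cz ->]]]] us] := hu [set w | exists x y z,
        [/\ A x, C z & w = r x y ⊗ s y z]].
      apply: qle_trans (UrelE_le _ FA HC) _.
      apply: qsup_le => _ [x [z [Ax Cz ->]]]; apply: vcomp_le => y.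
      by apply: qsup_ub; exists x, y, z.
    by exists (x, y, z).
  apply: qle_trans (vcompE_le _ _ _ (Umap (fun t => t.1.2) W) _).
  apply: qle_trans (xi_ge WE) _; apply: qle_trans (xi_ten HV _ _ _) _.
  by rewrite -WF -WH; apply: qten_mono; exact: xi_le_Urel.
- apply: vcomp_le => G; apply: qinf_ge => _ [A [C [FA HC ->]]].
  apply: ten_below_le => v hv; rewrite qtenC; apply: ten_below_le => u hu.
  rewrite qtenC.
  (* If the complement belonged to [G], then [u], being totally below [Urel r F G], would lie below
     some [r x y] with [x] in [A] and [y] in that complement. *)
  have Gu : sval G [set y | exists2 x, A x & u ⊑ r x y].
    have [//|Gn] := in_ultra_setVsetC [set y | exists2 x, A x & u ⊑ r x y] (U_ultra G).
    have [_ [x [y [Ax ny ->]]] ur] := hu _ (UrelE_le _ FA Gn).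
    by exfalso; apply: ny; exists x.
  have Gv : sval G [set y | exists2 z, C z & v ⊑ s y z].
    have [//|Gn] := in_ultra_setVsetC [set y | exists2 z, C z & v ⊑ s y z] (U_ultra G).
    have [_ [y [z [ny Cz ->]]] vs] := hv _ (UrelE_le _ Gn HC).
    by exfalso; apply: ny; exists z.
  have [y [[x Ax ur] [z Cz vs]]] := U_ex (UI Gu Gv).
  apply: (@qle_trans _ (vcomp s r x z)); last by apply: qsup_ub; exists x, z.
  by apply: qle_trans (vcompE_le _ _ _ y _); exact: qten_mono.
Qed.

(* The Beck-Chevalley condition for the multiplication of the ultrafilter monad. *)
Lemma Umult_BC T Y (f : T -> Y) (W : U T) (GG : U (U Y)) : Umult GG = Umap f W ->
  exists WW : U (U T), Umult WW = W /\ Umap (Umap f) WW = GG.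
Proof.
move=> h.
have [WW HW] : exists WW : U (U T), forall D, [set sharp p.1 `&` Umap f @^-1` p.2 |
    p in [set p | sval W p.1 /\ sval GG p.2]] D -> sval WW D.
  apply: U_extend.
  - by exists (sharp setT `&` Umap f @^-1` setT); exists (setT, setT) => //=;
      split; exact: UT.
  - move=> _ _ [[A B] /= [FA GB] <-] [[A' B'] /= [FA' GB'] <-].
    exists (sharp (A `&` A') `&` Umap f @^-1` (B `&` B')).
      by exists (A `&` A', B `&` B') => //=; split; exact: UI.
    by move=> F [FAA' [? ?]]; split; split=> //; apply: US FAA' => x [].
  - move=> _ [[A B] /= [WA GB] <-].
    (* The finite intersection property: some [G] in [B] contains [f(A)], so it lifts along [f] to
       an ultrafilter containing [A]. *)
    have GA : sval (Umult GG) (f @` A) by rewrite h; apply: US WA => x Ax; exists x.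
    have [G [/= GA' BG]] := U_ex (UI (GA : sval GG (sharp _)) GB).
    have [F [_ FG FA]] : exists F : U T, [/\ Umap (fun=> tt) F = Uunit tt,
        Umap f F = G & sval F A].
      apply: U_lift => B' C /principal_filterP B't GC.
      by have [_ [[x Ax <-] Cx]] := U_ex (UI (GA' : sval G _) GC); exists x.
    by exists F; split=> //=; rewrite FG.
exists WW; split.
- apply/esym/U_sub_eq => A FA; apply: US (HW _ (ex_intro2 _ _ (A, setT) _ erefl)).
    by move=> t [].
  by split=> //; exact: UT.
- apply/esym/U_sub_eq => A FA; apply: US (HW _ (ex_intro2 _ _ (setT, A) _ erefl)).
    by move=> t [].
  by split=> //; exact: UT.
Qed.

(** One inequality is formal. For the other, a coupling of [F] with [Umult GG] is lifted by
    Beck-Chevalley to an ultrafilter of couplings, whose first projection is the required [FF]. *)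
Lemma Umult_natural X Y (r : vrel V X Y) :
  vcomp (Urel (Urel r)) (vopp (graph V (@Umult X))) =
  vcomp (vopp (graph V (@Umult Y))) (Urel r).
Proof.
apply: vrel_anti => F GG.
- apply: vcomp_le => FF; rewrite /vopp {1}/graph; case: pselect => [/= <-|/= _];
    last by rewrite qtenbot; exact: qbot_le.
  rewrite qten1; apply: qle_trans (vcompE_le _ _ _ (Umult GG) _).
  rewrite graph_refl qtenk; apply: qinf_ge => _ [A [B [FA GB ->]]].
  apply: qle_trans (UrelE_le _ (FA : sval FF (sharp A)) (GB : sval GG (sharp B))) _.
  by apply: qsup_le => _ [F' [G' [FA' GB' ->]]]; exact: UrelE_le.
- apply: vcomp_le => G; rewrite /vopp {1}/graph; case: pselect => [h|_] /=;
    last by rewrite qtenC qtenbot; exact: qbot_le.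
  rewrite qtenk; apply: (below_le HV) => u hu; rewrite -h in hu *.
  have [W [WF WG WE]] := Urel_witness hu.
  have [WW [mW WWG]] := Umult_BC (esym WG).
  apply: qle_trans (vcompE_le _ _ _ (Umap (Umap fst) WW) _).
  rewrite -{1}WF -mW -Umult_map graph_refl qten1 -WWG.
  apply: qle_trans (xi_le_Urel _ _ _ _); apply: xi_ge.
  have : sval WW (sharp [set p | u ⊑ r p.1 p.2]) by rewrite -mW in WE.
  apply: US => w wE; apply: qle_trans (xi_le_Urel _ _ _ _); exact: xi_ge.
Qed.

(** A formal consequence of functoriality of [Urel], naturality of [Umult] with respect to
    relations, and associativity of the ultrafilter monad. *)
Lemma kleisliA W X Y Z (t : vrel V (U Y) Z) (s : vrel V (U X) Y) (r : vrel V (U W) X) :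
  t ∘ (s ∘ r) = t ∘ s ∘ r.
Proof.
rewrite /kleisli !Urel_comp Urel_graph -!vcompA vcomp_graph.
have -> : (fun x : U (U (U W)) => Umult (Umap (@Umult W) x)) = (fun x => Umult (Umult x)).
  by apply/funext => F; exact: Umult_mult.
by rewrite -vcomp_graph [vcomp (Urel (Urel r)) (vcomp _ _)]vcompA Umult_natural !vcompA.
Qed.

Lemma kleisli_mono X Y Z (s s' : vrel V (U Y) Z) (r r' : vrel V (U X) Y) :
  vrle s s' -> vrle r r' -> vrle (s ∘ r) (s' ∘ r').
Proof.
move=> ss rr F z; apply: kleisli_le => FF G <-.
by apply: qle_trans (kleisli_ge _ _ _ G _); apply: qten_mono; [exact: Urel_mono|].
Qed.

(** * Modules and adjoint maps *)

Lemma kleisli_unitr (X : space V) Y (phi : vrel V (U X) Y) :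
  vrle phi (phi ∘ @cvg V X).
Proof.
move=> F y; rewrite -{2}(Umult_map_unit F).
apply: qle_trans (kleisli_ge _ _ _ F _); apply: qle_kten.
by rewrite -{2}(Umap_id F); apply: Urel_map => x; exact: cvg_refl.
Qed.

Lemma kleisli_unitl X (Y : space V) (phi : vrel V (U X) Y) :
  vrle phi (@cvg V Y ∘ phi).
Proof.
move=> F y; rewrite -{2}(Umult_unit F).
apply: qle_trans (kleisli_ge _ _ _ (Uunit y) _).
by rewrite Urel_unit; apply: qle_tenk; exact: cvg_refl.
Qed.

(** The opposite inequalities are automatic, since the structures of [X] and [Y] are reflexive. *)
Lemma module_le (X Y : space V) (phi : vrel V (U X) Y) :
  vrle (phi ∘ @cvg V X) phi -> vrle (@cvg V Y ∘ phi) phi -> is_module phi.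
Proof.
move=> h h'; split; apply: vrel_anti => //; first exact: kleisli_unitr.
exact: kleisli_unitl.
Qed.

Lemma cvg_kleisli (X : space V) : vrle (@cvg V X ∘ @cvg V X) (@cvg V X).
Proof. by move=> F x; apply: kleisli_le => FF G <-; exact: cvg_trans. Qed.

Lemma cvg_module (X : space V) : is_module (@cvg V X : vrel V (U X) X).
Proof. by apply: module_le; exact: cvg_kleisli. Qed.

Lemma module_comp (X Y Z : prespace V) (psi : vrel V (U Y) Z) (phi : vrel V (U X) Y) :
  is_module psi -> is_module phi -> is_module (psi ∘ phi).
Proof.
move=> [_ hpsi] [hphi _]; split; first by rewrite -kleisliA hphi.
by rewrite kleisliA hpsi.
Qed.

Lemma kleisli_monol X Y Z (s s' : vrel V (U Y) Z) (r : vrel V (U X) Y) :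
  vrle s s' -> vrle (s ∘ r) (s' ∘ r).
Proof. by move=> ss; apply: kleisli_mono => // F y; exact: qle_refl. Qed.

Lemma kleisli_monor X Y Z (s : vrel V (U Y) Z) (r r' : vrel V (U X) Y) :
  vrle r r' -> vrle (s ∘ r) (s ∘ r').
Proof. by apply: kleisli_mono => F y; exact: qle_refl. Qed.

Lemma module_le_comp (X Y : prespace V) (phi : vrel V (U X) Y) (alpha : vrel V (U X) X) :
  is_module phi -> vrle (@cvg V X) alpha -> vrle phi (phi ∘ alpha).
Proof. by move=> [e _] /(kleisli_monor phi); rewrite e. Qed.

Lemma module_comp_le (X Y : prespace V) (phi : vrel V (U X) Y) (alpha : vrel V (U X) X) :
  is_module phi -> vrle alpha (@cvg V X) -> vrle (phi ∘ alpha) phi.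
Proof. by move=> [e _] /(kleisli_monor phi); rewrite e. Qed.

Lemma upper_star_module (X Y : space V) (f : X -> Y) : is_map f ->
  is_module (upper_star f).
Proof.
move=> mf; apply: module_le => F x.
  exact: (@cvg_kleisli Y F (f x)).
apply: kleisli_le => FF G <-.
apply: qle_trans (cvg_trans _ (Umap f G) _); apply: qten_mono; last exact: mf.
rewrite /upper_star (Urel_preim (@cvg V Y) (fun x => x) f) Umap_id.
exact: qle_refl.
Qed.

Lemma lower_star_module (X Y : space V) (f : X -> Y) : is_map f ->
  is_module (lower_star f).
Proof.
move=> mf; apply: module_le => F x; apply: kleisli_le => FF G <-.
  rewrite /lower_star -Umult_map; apply: qle_trans (cvg_trans _ (Umap f G) _).
  apply: qten_mono; last exact: qle_refl.
  rewrite -(Urel_preim (@cvg V Y) (Umap f) f); apply: Urel_mono => H y; exact: mf.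
rewrite /lower_star -Umult_map; apply: qle_trans (cvg_trans _ G _).
rewrite (Urel_preim (@cvg V Y) (Umap f) (fun x => x)) Umap_id.
exact: qle_refl.
Qed.

Lemma kleisli_lower (X Y : space V) Z (phi : vrel V (U Y) Z) (f : X -> Y) F z :
  phi ∘ @cvg V Y = phi -> (phi ∘ lower_star f) F z = phi (Umap f F) z.
Proof.
move=> hphi; apply: qle_anti; last first.
  rewrite -{2}(Umult_map_unit F); apply: qle_trans (kleisli_ge _ _ _ (Umap f F) _).
  apply: qle_kten; apply: Urel_map => x.
  by rewrite /lower_star Umap_unit; exact: cvg_refl.
apply: kleisli_le => FF G <-; rewrite -{2}hphi -Umult_map.
apply: qle_trans (kleisli_ge _ _ _ G _); apply: qten_mono; last exact: qle_refl.
rewrite /lower_star (Urel_preim (@cvg V Y) (Umap f) (fun x => x)) Umap_id.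
exact: qle_refl.
Qed.

Lemma star_unit (X Y : space V) (f : X -> Y) : is_map f ->
  vrle (@cvg V X) (upper_star f ∘ lower_star f).
Proof.
move=> mf F x; rewrite kleisli_lower; first exact: mf.
by have [] := upper_star_module mf.
Qed.

Lemma star_counit (X Y : space V) (f : X -> Y) :
  vrle (lower_star f ∘ upper_star f) (@cvg V Y).
Proof.
move=> F y; apply: kleisli_le => FF G <-.
rewrite /upper_star (Urel_preim (@cvg V Y) (fun x => x) f) Umap_id.
exact: cvg_trans.
Qed.

Lemma one_is_space : is_space (one V).
Proof.
split=> [F x|F x]; first by rewrite /vopp /graph; case: pselect => _ /=;
  [exact: qle_refl|exact: qbot_le].
apply: (@kleisli_le V _ _ _ (@cvg V (one V)) (@cvg V (one V))) => FF G _.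
rewrite qtenk; apply: qle_trans (UrelE_le _ (UT FF) (UT G)) _.
by apply: qsup_le => _ [? [? [_ _ ->]]]; exact: qle_refl.
Qed.

Definition one_space : space V := Space one_is_space.

Lemma cvg_unit_trans (X : space V) (F : U X) (x y : X) :
  cvg F x ⊗ cvg (Uunit x) y ⊑ cvg F y.
Proof.
rewrite -{2}(Umult_unit F); apply: qle_trans (cvg_trans _ (Uunit x) _).
by rewrite Urel_unit; exact: qle_refl.
Qed.

Lemma cvg_mono (X : space V) (F : U X) (x y : X) : ple x y -> cvg F x ⊑ cvg F y.
Proof.
by move=> xy; apply: qle_trans (cvg_unit_trans _ x _); exact: qle_tenk.
Qed.

Lemma cvg_anti (T : Type) (X : space V) (f g : T -> X) F x :
  (forall t, ple (f t) (g t)) -> cvg (Umap g F) x ⊑ cvg (Umap f F) x.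
Proof.
move=> fg; rewrite -(Umult_map_unit (Umap f F)).
apply: qle_trans (cvg_trans _ (Umap g F) _).
by apply: qle_kten; rewrite Umap_comp; exact: Urel_map.
Qed.

(** The adjunction [f ⊣ g] in module form, [f_* = g^*]; it lets convergence be moved along an
    adjunction. *)
Lemma adjoint_cvg (X Y : space V) (f : X -> Y) (g : Y -> X) F y : adjoint f g ->
  cvg (Umap f F) y = cvg F (g y).
Proof.
move=> [mf mg u c]; apply: qle_anti.
  apply: qle_trans (mg _ _) _; rewrite Umap_comp -{2}(Umap_id F).
  exact: (@cvg_anti X X (fun x => x) (fun x => g (f x))).
by apply: qle_trans (mf _ _) _; exact/cvg_mono/c.
Qed.

Lemma adjoint_ple (X Y : space V) (f : X -> Y) (g : Y -> X) x y : adjoint f g ->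
  ple (f x) y <-> ple x (g y).
Proof. by move=> /(adjoint_cvg (Uunit x) y); rewrite Umap_unit /ple => ->. Qed.

Lemma adjoint_uniq (X Y : space V) (f f' : X -> Y) (g : Y -> X) : T0 Y ->
  adjoint f g -> adjoint f' g -> f = f'.
Proof.
move=> T0Y a a'; apply/funext => x; apply: T0Y.
  by apply/(adjoint_ple _ _ a)/(adjoint_ple _ _ a'); exact: cvg_refl.
by apply/(adjoint_ple _ _ a')/(adjoint_ple _ _ a); exact: cvg_refl.
Qed.

Lemma adjoint_uniqr (X Y : space V) (f : X -> Y) (g g' : Y -> X) : T0 X ->
  adjoint f g -> adjoint f g' -> g = g'.
Proof.
move=> T0X a a'; apply/funext => x; apply: T0X.
  by apply/(adjoint_ple _ _ a')/(adjoint_ple _ _ a); exact: cvg_refl.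
by apply/(adjoint_ple _ _ a)/(adjoint_ple _ _ a'); exact: cvg_refl.
Qed.

(** * The space of presheaves *)

Section Presheaf.
Variable X : space V.

(** The universal module out of [X]; by the Yoneda lemma it is [y_*], see [lower_yoneda]. *)
Definition eval : vrel V (U X) (presheaf X) := fun F psi => sval psi F tt.

(* The largest structure through which [eval] is a module out of [X]. *)
Definition pcvg : vrel V (U (presheaf X)) (presheaf X) := fun Q psi =>
  qsup [set v | forall FF, v ⊗ Urel eval FF Q ⊑ eval (Umult FF) psi].

Lemma pcvgP v Q psi :
  v ⊑ pcvg Q psi <-> forall FF, v ⊗ Urel eval FF Q ⊑ eval (Umult FF) psi.
Proof.
split=> [h FF|h]; last exact: qsup_ub.
apply: (@qle_trans _ (pcvg Q psi ⊗ Urel eval FF Q)).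
  by apply: qten_mono => //; exact: qle_refl.
by rewrite qtenC; apply: qten_sup_le => w hw; rewrite qtenC.
Qed.

Lemma pcvg_eval : vrle (pcvg ∘ eval) eval.
Proof.
move=> F psi; apply: kleisli_le => FF Q <-; rewrite qtenC; move: FF.
by apply/pcvgP; exact: qle_refl.
Qed.

Lemma le_pcvg (alpha : vrel V (U (presheaf X)) (presheaf X)) :
  vrle (alpha ∘ eval) eval -> vrle alpha pcvg.
Proof.
move=> h Q psi; apply/pcvgP => FF; rewrite qtenC.
by apply: qle_trans (h _ _); exact: kleisli_ge.
Qed.

(** Restricting [eval] to the single point [psi] gives the module [psi] itself, so the inequality is
    its module law on the side of the one-point space. *)
Lemma Urel_eval_unit FF (psi : presheaf X) :
  Urel eval FF (Uunit psi) ⊑ eval (Umult FF) psi.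
Proof.
have -> : Uunit psi = Umap (fun=> psi) (Uunit tt) by rewrite Umap_unit.
rewrite -{1}(Umap_id FF) -(Urel_preim eval (fun F => F) (fun=> psi)) /eval.
have -> : (fun F (_ : unit) => sval psi F tt) = sval psi.
  by apply: vrel_anti => F []; exact: qle_refl.
have [_ {2}<-] := svalP psi; rewrite -[Urel _ _ _]qtenk.
exact: (@kleisli_ge V _ _ _ (@cvg V (one V))).
Qed.

Lemma pcvg_unit v (psi psi' : presheaf X) :
  v ⊑ pcvg (Uunit psi) psi' <-> forall F, v ⊗ eval F psi ⊑ eval F psi'.
Proof.
rewrite pcvgP; split=> [h F|h FF].
  by have := h (Uunit F); rewrite Urel_unit Umult_unit.
by apply: qle_trans (h (Umult FF)); apply: qten_le; exact: Urel_eval_unit.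
Qed.

Lemma pcvg_is_space : is_space (Prespace pcvg).
Proof.
split=> [Q psi|].
  rewrite /vopp /graph; case: pselect => [/= <-|/= _]; last exact: qbot_le.
  by apply/pcvg_unit => F; rewrite qten1; exact: qle_refl.
(* Transitivity comes from maximality: by associativity, [pcvg ∘ pcvg] also acts on [eval], so it
   lies below the largest such relation. *)
apply: le_pcvg; rewrite -[vcomp _ _]/(kleisli pcvg pcvg) -kleisliA => F psi.
by apply: qle_trans (pcvg_eval _ _); apply: kleisli_monor; exact: pcvg_eval.
Qed.

Lemma is_map_pcvg (Z : space V) (h : Z -> presheaf X) :
  @is_map V Z (Prespace pcvg) h <->
  forall FF G z, Urel (fun F z => eval F (h z)) FF G ⊗ cvg G z ⊑ eval (Umult FF) (h z).
Proof.
have e FF G : Urel (fun F z => eval F (h z)) FF G = Urel eval FF (Umap h G).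
  by rewrite (Urel_preim eval (fun F => F) h) Umap_id.
split=> [mh FF G z|mh G z].
  by rewrite e qtenC; move: FF; apply/pcvgP; exact: mh.
by apply/pcvgP => FF; rewrite -e qtenC; exact: mh.
Qed.

Lemma pcvg_exponential : is_exponential pcvg.
Proof.
split; first exact: pcvg_is_space.
move=> Z h; rewrite is_map_pcvg; pose g (p : Z * U X) := eval p.2 (h p.1).
split=> [mh W [z F]|mh FF G z] /=.
  apply/(vcvgP HV); rewrite -qtenA -[h z]/(h (z, F).1).
  (* Expanding [h z] by its right module law exposes [Urel cvg] after the converse of [Umult], which
     is exactly the structure of [op X]. *)
  have -> : sval (h z) F = (sval (h z) ∘ @cvg V X) F by have [->] := svalP (h z).
  rewrite /kleisli -vcompA; apply: qle_trans (vcompE_le _ _ _ (Umult (Umap snd W)) _).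
  rewrite qtenA -/(eval _ _) [cvg _ _ ⊗ _]qtenC -qtenA; apply: qten_le.
  apply: qle_trans (mh _ (Umap fst W) _); rewrite qtenC; apply: qten_mono;
    last exact: qle_refl.
  exact: (xi_le_Urel (@snd Z (U X)) fst (fun F z => eval F (h z))).
rewrite qtenC; apply: (ten_below_le) => v hv.
have [W [WF WG WE]] := Urel_witness hv.
pose W' := Umap (fun p => (p.2, p.1)) W.
have := mh W' (z, Umult FF); rewrite /= !Umap_comp /= WF WG => /(vcvgP HV).
apply: qle_trans; apply: qten_mono; last exact: xi_ge.
(* In [op X] every [FF] converges to [Umult FF] with value at least [k]; the intermediate
   ultrafilter is the image of [Umult FF] under [Uunit]. *)
apply: qle_tenk; apply: qle_trans (vcompE_le _ _ _ (Umap (@Uunit X) (Umult FF)) _).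
rewrite /vopp -{2}(Umult_map_unit (Umult FF)) graph_refl qten1.
by rewrite -{2}(Umap_id (Umult FF)); apply: Urel_map => x; exact: cvg_refl.
Qed.

(** Uniqueness of exponentials: the identity is a map in both directions between two structures with
    the same universal property. *)
Lemma presheaf_cvgE : presheaf_cvg (X := X) = pcvg.
Proof.
rewrite /presheaf_cvg; case: pselect => [h|nh]; last first.
  by exfalso; apply: nh; exists pcvg; exact: pcvg_exponential.
case: (cid h) => c /= [cs ce]; have [ps pe] := pcvg_exponential.
apply: vrel_anti => Q psi.
  have := (pe (Space cs) id).2 ((ce (Space cs) id).1 (@is_map_id _ _)) Q psi.
  by rewrite Umap_id.
have := (ce (Space ps) id).2 ((pe (Space ps) id).1 (@is_map_id _ _)) Q psi.
by rewrite Umap_id.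
Qed.

End Presheaf.

Lemma P_is_space (X : space V) : is_space (P X).
Proof. by have := pcvg_is_space X; rewrite -presheaf_cvgE. Qed.

Definition Pspace (X : space V) : space V := Space (P_is_space X).

Lemma PcvgE (X : space V) : @cvg V (P X) = @pcvg X.
Proof. exact: presheaf_cvgE. Qed.

Lemma Pcvg_unit (X : space V) v (psi psi' : P X) :
  v ⊑ cvg (Uunit psi) psi' <-> forall F, v ⊗ sval psi F tt ⊑ sval psi' F tt.
Proof. by rewrite PcvgE; exact: pcvg_unit. Qed.

Lemma ple_P (X : space V) (psi psi' : P X) :
  ple psi psi' <-> vrle (sval psi) (sval psi').
Proof.
rewrite /ple Pcvg_unit; split=> [h F []|h F]; first by rewrite -[sval psi F tt]qten1.
by rewrite qten1; exact: h.
Qed.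

Lemma P_T0 (X : space V) : T0 (P X).
Proof.
move=> psi psi' /ple_P h /ple_P h'; apply: sval_inj; exact: vrel_anti.
Qed.

(** Transposition between maps [Z → P X] and modules from [X] to [Z]: the left law is [is_map_pcvg],
    and the right law holds pointwise because each [h z] is a module. *)
Lemma is_map_P (X Z : space V) (h : Z -> P X) :
  is_map h <-> is_module (X := X) (Y := Z) (fun F z => sval (h z) F tt).
Proof.
rewrite -[is_map h]/(@is_map V Z (Prespace (@cvg V (P X))) h) PcvgE is_map_pcvg.
split=> [mh|[_ mh] FF G z]; last first.
  by rewrite -[eval _ _]/((fun F z => sval (h z) F tt) (Umult FF) z) -{2}mh; exact: kleisli_ge.
apply: module_le => F z; last by apply: kleisli_le => FF G <-; exact: mh.
have [e _] := svalP (h z); have := qle_refl ((sval (h z) ∘ @cvg V X) F tt).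
by rewrite {2}e.
Qed.

Lemma eval_module (X : space V) : is_module (X := X) (Y := P X) (@eval X).
Proof. by apply/(@is_map_P X (Pspace X)); exact: is_map_id. Qed.

Lemma yoneda_map (X : space V) : is_map (@yoneda V X).
Proof. by apply/is_map_P; exact: cvg_module. Qed.

(** The Yoneda lemma. One inequality tests the definition of [pcvg] at the image of [F] under
    [Uunit]; the other is the right module law of [psi]. *)
Lemma yoneda_cvg (X : space V) F (psi : P X) :
  cvg (Umap (@yoneda V X) F) psi = sval psi F tt.
Proof.
have [h _] := svalP psi.
rewrite PcvgE; apply: qle_anti.
  have /pcvgP/(_ (Umap (@Uunit X) F)) := qle_refl (pcvg (Umap (@yoneda V X) F) psi).
  rewrite Umult_map_unit; apply: qle_trans; apply: qle_tenk; apply: Urel_map => x.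
  exact: cvg_refl.
apply/pcvgP => FF; rewrite /eval -{2}h qtenC.
apply: qle_trans (kleisli_ge _ _ _ F _); apply: qten_mono; last exact: qle_refl.
rewrite -{1}(Umap_id FF) -(Urel_preim (@eval X) (fun F => F)); exact: qle_refl.
Qed.

Lemma lower_yoneda (X : space V) : lower_star (@yoneda V X) = @eval X.
Proof.
apply: vrel_anti => F psi; rewrite /lower_star yoneda_cvg; exact: qle_refl.
Qed.

(** * Composition with a module as a map between presheaf spaces *)

Definition precomp (X Y : space V) (phi : vrel V (U X) Y) (hphi : is_module phi)
  (psi : P Y) : P X := exist _ (sval psi ∘ phi) (module_comp (svalP psi) hphi).

Lemma precomp_map (X Y : space V) (phi : vrel V (U X) Y) (hphi : is_module phi) :
  @is_map V (P Y) (P X) (precomp hphi).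
Proof.
apply/(@is_map_P X (Pspace Y)); rewrite -[fun _ _ => _]/(@eval Y ∘ phi).
exact: module_comp (eval_module Y) hphi.
Qed.

Lemma precomp_adjoint (X Y : space V) (phi : vrel V (U X) Y) (psi : vrel V (U Y) X)
  (hphi : is_module phi) (hpsi : is_module psi) :
  vrle (@cvg V X) (psi ∘ phi) -> vrle (phi ∘ psi) (@cvg V Y) ->
  @adjoint V (P X) (P Y) (precomp hpsi) (precomp hphi).
Proof.
move=> u c; split; [exact: precomp_map|exact: precomp_map| |] => chi; apply/ple_P.
  by rewrite /= -kleisliA; exact: (module_le_comp (svalP chi)).
by rewrite /= -kleisliA; exact: (module_comp_le (svalP chi)).
Qed.

Definition lower_pre (X Y : space V) (f : X -> Y) (mf : is_map f) : P Y -> P X :=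
  precomp (lower_star_module mf).

Definition upper_pre (X Y : space V) (f : X -> Y) (mf : is_map f) : P X -> P Y :=
  precomp (upper_star_module mf).

Lemma lower_preE (X Y : space V) (f : X -> Y) (mf : is_map f) psi F :
  sval (lower_pre mf psi) F tt = sval psi (Umap f F) tt.
Proof. by apply: kleisli_lower; have [] := svalP psi. Qed.

Lemma upper_lower_adjoint (X Y : space V) (f : X -> Y) (mf : is_map f) :
  @adjoint V (P X) (P Y) (upper_pre mf) (lower_pre mf).
Proof. by apply: precomp_adjoint; [exact: star_unit|exact: star_counit]. Qed.

(** * Presheaf spaces are totally algebraic *)

(** Suprema in [P X] are composition with [y_*]: the unit uses [y_* = eval] and the definition of
    [pcvg], and the counit is the Yoneda lemma. *)
Lemma Sup_P_adjoint (X : space V) :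
  @adjoint V (P (Pspace X)) (P X) (@lower_pre X (Pspace X) _ (@yoneda_map X))
    (@yoneda V (Pspace X)).
Proof.
split; [exact: precomp_map|exact: (@yoneda_map (Pspace X))| |] => psi; apply/ple_P.
  move=> Q []; rewrite -[sval (yoneda _) _ _]/(@cvg V (P X) Q _) PcvgE; apply/pcvgP => FF.
  rewrite qtenC /eval /lower_pre /= lower_yoneda; exact: kleisli_ge.
move=> F []; rewrite lower_preE.
rewrite -[sval (yoneda _) _ _]/(@cvg V (P X) (Umap (@yoneda V X) F) _) yoneda_cvg.
exact: qle_refl.
Qed.

Lemma P_completely_distributive (X : space V) : completely_distributive (Pspace X).
Proof.
exists (@lower_pre X (Pspace X) _ (@yoneda_map X)); first exact: Sup_P_adjoint.
exists (@upper_pre X (Pspace X) _ (@yoneda_map X)); exact: upper_lower_adjoint.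
Qed.

(** The Yoneda embedding equalises [t] and [y], hence factors through [i]. So the image of [i]
    contains all representables, and these suffice to recover any presheaf as a supremum. *)
Lemma P_totally_algebraic (X : space V) : totally_algebraic (Pspace X).
Proof.
split; first exact: P_completely_distributive.
move=> Sup t aSup at_ A i [mi ei ui] psi.
have hS : Sup = @lower_pre X (Pspace X) _ (@yoneda_map X).
  apply: (@adjoint_uniq (Pspace (Pspace X)) (Pspace X)) aSup (Sup_P_adjoint X).
  exact: P_T0.
have ht : t = @upper_pre X (Pspace X) _ (@yoneda_map X).
  rewrite hS in at_; apply: (@adjoint_uniq (Pspace X) (Pspace (Pspace X))) at_ _.
    exact: P_T0.
  exact: upper_lower_adjoint.
have [h [[mh ih] _]] : exists! h : X -> A, is_map h /\ forall x, i (h x) = yoneda x.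
  apply: ui; first exact: yoneda_map.
  move=> x; apply: sval_inj; rewrite ht; apply/funext => Q; apply/funext => -[].
  have [_ e] := @upper_star_module X (Pspace X) _ (@yoneda_map X).
  exact: (congr1 (fun r => r Q x) e).
have mod := module_comp (point_star_module (psi : Pspace X))
  (module_comp (lower_star_module mi) (upper_star_module mi)).
(* The first inequality needs only the counit [i_* ∘ i^* ⊑ a] and the counit of [Sup ⊣ y]; the
   second uses the factorisation [h]. *)
exists (exist _ _ mod); split=> //; split.
  have [mS _ _ c] := aSup; apply: (@ple_trans _ (Pspace X)) (c psi).
  apply: (@is_map_ple _ (P (Pspace X)) (P X)) => //.
  apply/ple_P => Q []; have := @star_counit _ _ i Q psi.
  by have [_ {1}<-] := module_comp (lower_star_module mi) (upper_star_module mi).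
rewrite hS; apply/ple_P => F []; rewrite lower_preE /=.
have -> : Umap (@yoneda V X) F = Umap i (Umap h F).
  by rewrite Umap_comp; congr Umap; apply/funext => x; rewrite ih.
rewrite -[kleisli _ _ _ _]/((@cvg V (Pspace X) ∘ (lower_star i ∘ upper_star i))
  (Umap i (Umap h F)) psi).
apply: qle_trans (kleisli_unitl _ _ _).
rewrite -(@kleisli_lower A (Pspace X)); last first.
  by have [] := module_comp (lower_star_module mi) (upper_star_module mi).
rewrite -kleisliA; apply: (@qle_trans _ ((lower_star i ∘ @cvg V A) (Umap h F) psi)).
  have [-> _] := lower_star_module mi; rewrite /lower_star Umap_comp.
  have -> : (fun x => i (h x)) = @yoneda V X by apply/funext.
  by rewrite yoneda_cvg; exact: qle_refl.
by apply: kleisli_monor; exact: star_unit.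
Qed.

(** * Totally algebraic spaces are presheaf spaces *)

Lemma point_star_inj (X : space V) (x y : X) : T0 X ->
  point_star x = point_star y -> x = y.
Proof.
move=> T0X e; have ce F : cvg F x = cvg F y := congr1 (fun r => r F tt) e.
by apply: T0X; rewrite /ple; [rewrite -ce|rewrite ce]; exact: cvg_refl.
Qed.

Lemma cst_map (X : space V) (x : X) : @is_map V (one V) X (fun=> x).
Proof.
move=> F y; have -> : Umap (fun=> x) F = Uunit x; last exact: cvg_refl.
by apply: U_sub_eq => A /(@U_ex _ F)[z Ax]; apply/principal_filterP; exact: Ax.
Qed.

Lemma point_adjoint (X Y : space V) (phi : vrel V (U X) Y) (psi : vrel V (U Y) X) x :
  module_adjoint phi psi ->
  module_adjoint (phi ∘ @lower_star V (one V) X (fun=> x)) (point_star x ∘ psi).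
Proof.
move=> [mphi mpsi u c]; have m := @lower_star_module one_space X _ (@cst_map X x).
have m' : is_module (point_star x) := point_star_module x.
split; [exact: module_comp|exact: module_comp| |].
  have u1 := @star_unit one_space X _ (@cst_map X x).
  rewrite kleisliA -[point_star x ∘ psi ∘ phi]kleisliA => F z.
  apply: qle_trans (u1 F z) _; apply: kleisli_monol.
  exact: (module_le_comp m').
have c1 := @star_counit one_space X (fun=> x).
rewrite kleisliA -[phi ∘ _ ∘ point_star x]kleisliA => F z.
apply: qle_trans (c F z); apply: kleisli_monol; exact: (module_comp_le mphi).
Qed.

Lemma cvg_module_adjoint (X : space V) : module_adjoint (@cvg V X : vrel V (U X) X) (@cvg V X).
Proof.
split; [exact: cvg_module|exact: cvg_module|exact: kleisli_unitr|exact: cvg_kleisli].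
Qed.

(** Each [x^*] is a right adjoint module and equivalent points have the same [x^*], so the
    uniqueness part of sobriety applies. *)
Lemma sober_T0 (X : space V) : sober X -> T0 X.
Proof.
move=> sX x y xy yx.
have [|z [_ uz]] := sX (point_star x) (point_star_module x).
  exists (@cvg V X ∘ @lower_star V (one V) X (fun=> x)).
  have := point_adjoint x (cvg_module_adjoint X).
  by have [-> _] := point_star_module x.
rewrite -(uz x erefl); apply: uz; apply: vrel_anti => F t; exact: cvg_mono.
Qed.

(** * Recovering a sober space from a totally algebraic space *)

Section EssentialImage.
Variables (L : space V) (Sup : P L -> L) (t : L -> P L).
Hypotheses (T0L : T0 L) (aSup : adjoint Sup (@yoneda V L)) (at_ : adjoint t Sup).

Definition core_prespace : prespace V :=
  @Prespace V {x : L | t x = yoneda x} (fun F x => cvg (Umap sval F) (sval x)).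

Lemma core_is_space : is_space core_prespace.
Proof.
split=> [F x|F x].
  rewrite /vopp /graph; case: pselect => [/= <-|/= _]; last exact: qbot_le.
  by rewrite Umap_unit; exact: cvg_refl.
apply: (@kleisli_le V _ _ _ (@cvg V core_prespace) (@cvg V core_prespace)) => FF G <-.
rewrite /= -Umult_map; apply: qle_trans (cvg_trans _ (Umap sval G) _).
rewrite (Urel_preim (@cvg V L) (Umap sval) sval); exact: qle_refl.
Qed.

Definition core : space V := Space core_is_space.
Definition incl : core -> L := sval.

Lemma incl_map : is_map incl. Proof. by move=> F x; exact: qle_refl. Qed.

Lemma core_equaliser : @is_equaliser V core L (P L) incl t (@yoneda V L).
Proof.
split; [exact: incl_map|by case|].
move=> Z h mh eh; exists (fun z => exist _ (h z) (eh z) : core); split.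
  by split=> // F x; rewrite /= Umap_comp; exact: mh.
by move=> h' [_ e]; apply/funext => z; apply: sval_inj; exact/esym/e.
Qed.

Lemma core_T0 : T0 core.
Proof.
move=> x y; rewrite /ple /= !Umap_unit => xy yx; apply: sval_inj; exact: T0L.
Qed.

Definition nerve (x : L) : P core := lower_pre incl_map (yoneda x).
Definition realise (psi : P core) : L := Sup (upper_pre incl_map psi).

Lemma t_incl F : Umap t (Umap incl F) = Umap (@yoneda V L) (Umap incl F).
Proof. by rewrite !Umap_comp; congr Umap; apply/funext => -[]. Qed.

(** The adjunction [t ⊣ Sup] transfers the convergence to [P L]; there [t] agrees with [y] on the
    core, so the Yoneda lemma applies, and [i^* ∘ i_* = a] removes the inclusion. *)
Lemma cvg_realise F (psi : P core) : cvg (Umap incl F) (realise psi) = sval psi F tt.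
Proof.
rewrite -(@adjoint_cvg L (Pspace L) _ _ _ _ at_).
rewrite -[LHS]/(@cvg V (P L) (Umap t (Umap incl F)) (upper_pre incl_map psi)).
rewrite t_incl yoneda_cvg /= -(@kleisli_lower core L _ _ incl); last first.
  by have [] := svalP (upper_pre incl_map psi).
rewrite -kleisliA; have [e _] := svalP psi.
suff -> : upper_star incl ∘ lower_star incl = @cvg V core by rewrite e.
apply: vrel_anti => G x; rewrite kleisli_lower; do ?[exact: qle_refl];
  by have [] := upper_star_module incl_map.
Qed.

Lemma nerve_realise psi : nerve (realise psi) = psi.
Proof.
apply: sval_inj; apply/funext => F; apply/funext => -[].
by rewrite lower_preE; exact: cvg_realise.
Qed.

Lemma t_realise psi : t (realise psi) = upper_pre incl_map psi.
Proof.
apply: P_T0.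
  apply/(@adjoint_ple L (Pspace L) _ _ _ _ at_); exact: cvg_refl.
apply/(@adjoint_ple (Pspace core) (Pspace L) _ _ _ _ (upper_lower_adjoint incl_map)).
apply/ple_P => F []; rewrite lower_preE -(@yoneda_cvg L) -t_incl -cvg_realise.
by have [mt _ _ _] := at_; exact: mt.
Qed.

Lemma core_sober : sober core.
Proof.
move=> psi mpsi [phi [mphi _ u c]].
pose Psi : P core := exist _ psi mpsi; pose x := realise Psi.
have mi := lower_star_module incl_map; have mi' := upper_star_module incl_map.
have c' : vrle (lower_star incl ∘ phi ∘ (psi ∘ upper_star incl)) (@cvg V L).
  move=> F y; apply: qle_trans (star_counit incl F y).
  rewrite kleisliA -[_ ∘ phi ∘ psi]kleisliA.
  by apply: kleisli_monol; exact: (module_comp_le mi).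
have u' : vrle (@cvg V (one V)) (psi ∘ upper_star incl ∘ (lower_star incl ∘ phi)).
  move=> F y; apply: qle_trans (u F y) _.
  rewrite kleisliA -[_ ∘ lower_star incl]kleisliA.
  apply: kleisli_monol; apply: (module_le_comp mpsi); exact: star_unit incl_map.
(* The left adjoint lies below [x_*]: by [Sup ⊣ y], the value [cvg (Uunit x) w] is the convergence
   of [psi ∘ i^*] to [w^*] in [P L], which the counit [c'] bounds from below. *)
have le_x (w : L) G : (lower_star incl ∘ phi) G w ⊑ cvg (Uunit x) w.
  rewrite -[Uunit x]/(Uunit (Sup (upper_pre incl_map Psi))) -(Umap_unit Sup).
  rewrite (@adjoint_cvg (Pspace L) L _ _ _ _ aSup).
  have -> : G = Uunit tt.
    by apply/esym/U_sub_eq => A /principal_filterP At; apply: US (UT G) => -[].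
  apply/Pcvg_unit => F; apply: qle_trans (c' F w).
  rewrite -{2}(Umult_unit F); apply: qle_trans (kleisli_ge _ _ _ (Uunit tt) _).
  by rewrite Urel_unit qtenC; exact: qle_refl.
have tx : t x = yoneda x.
  rewrite t_realise; apply: P_T0.
    by have [_ _ ux _] := aSup; exact: ux.
  apply/ple_P => F [].
  have mp := point_star_module x.
  (* The chain is [x^* ⊑ psi ∘ i^* ∘ i_* ∘ phi ∘ x^* ⊑ psi ∘ i^*]: the unit [u'] comes first, then
     [le_x] reduces the last three factors to [x_* ∘ x^* ⊑ a]. *)
  apply: (@qle_trans _
    ((psi ∘ upper_star incl ∘ (lower_star incl ∘ phi) ∘ point_star x) F tt)).
    by have [_ e] := mp; have := @kleisli_monol _ _ _ _ _ (point_star x) u' F tt; rewrite e.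
  rewrite -kleisliA; apply: (module_comp_le (module_comp mpsi mi')) => {}F y.
  apply: kleisli_le => FF G <-.
  apply: qle_trans (cvg_unit_trans _ x _); apply: qten_mono; last exact: le_x.
  have [_ /(congr1 (fun r => r (Umult FF) tt))] := mp.
  rewrite -[cvg _ _]/(point_star x (Umult FF) tt) => <-.
  rewrite -[Urel _ _ _]qtenk; exact: (@kleisli_ge V _ _ _ (@cvg V (one V))).
exists (exist _ x tx : core); split.
  by apply/funext => F; apply/funext => -[]; exact/esym/(cvg_realise F Psi).
move=> y e; apply: (point_star_inj core_T0); rewrite -e.
by apply/funext => F; apply/funext => -[]; exact: (cvg_realise F Psi).
Qed.

Lemma nerve_map : is_map nerve.
Proof. by apply: is_map_comp; [exact: precomp_map|exact: yoneda_map]. Qed.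

Lemma realise_map : is_map realise.
Proof. by have [mS _ _ _] := aSup; apply: is_map_comp => //; exact: precomp_map. Qed.

Lemma realise_nerve x : totally_algebraic L -> realise (nerve x) = x.
Proof.
move=> [_ /(_ _ _ aSup at_ _ _ core_equaliser x) [psi [e [h h']]]].
suff -> : realise (nerve x) = Sup psi by exact: T0L.
by congr Sup; apply: sval_inj; rewrite e; exact/esym/kleisliA.
Qed.

End EssentialImage.

(** * Maps with two adjoints between presheaf spaces *)

Lemma precomp_yoneda (X Y : space V) (phi : vrel V (U X) Y) (hphi : is_module phi) F y :
  sval (precomp hphi (yoneda y)) F tt = phi F y.
Proof. by have [_ e] := hphi; exact: (congr1 (fun r => r F y) e). Qed.

(* A module [phi], seen as a map [Y -> P X], has the "nerve"
   [psi |-> psi^* ∘ phi_*]; it is right adjoint to composition with [phi]. *)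
Lemma precomp_left_adjoint (X Y : space V) (phi : vrel V (U X) Y) (hphi : is_module phi) :
  exists r : P X -> P Y, @adjoint V (P Y) (P X) (precomp hphi) r.
Proof.
pose m y : P X := precomp hphi (yoneda y).
have mm : @is_map V Y (Pspace X) m.
  by apply: is_map_comp; [exact: precomp_map|exact: yoneda_map].
pose r psi := @lower_pre Y (Pspace X) _ mm (@yoneda V (Pspace X) psi).
have rE psi F : sval (r psi) F tt = cvg (Umap m F) (psi : P X).
  exact: (@lower_preE Y (Pspace X) m mm).
exists r; split; first exact: precomp_map.
- apply: (@is_map_comp _ _ (P (Pspace X))); first exact: precomp_map.
  exact: (@yoneda_map (Pspace X)).
- move=> psi; apply/ple_P => F []; rewrite rE -yoneda_cvg.
  by apply: qle_trans (precomp_map hphi _ _) _; rewrite Umap_comp; exact: qle_refl.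
- move=> psi; apply/ple_P => F []; apply: kleisli_le => FF G <-.
  rewrite -[sval _ G tt]/(sval (r psi) G tt).
  rewrite rE PcvgE qtenC.
  have -> : Urel phi FF G = Urel (@eval X) FF (Umap m G).
    rewrite -{2}(Umap_id FF) -(Urel_preim (@eval X) (fun F => F)); congr Urel.
    by apply/funext => F'; apply/funext => y; rewrite /eval precomp_yoneda.
  by move: FF; apply/pcvgP; exact: qle_refl.
Qed.

Lemma left_adjoint_precomp (X Y : space V) (f : P Y -> P X) (r : P X -> P Y) :
  @adjoint V (P Y) (P X) f r ->
  exists (phi : vrel V (U X) Y) (hphi : is_module phi), f = precomp hphi.
Proof.
move=> a; have [mf _ _ _] := a.
have hphi : is_module (X := X) (Y := Y) (fun F y => sval (f (yoneda y)) F tt).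
  apply/(@is_map_P X Y (fun y => f (yoneda y))).
  by apply: is_map_comp => //; exact: yoneda_map.
exists _, hphi; have [r' a'] := precomp_left_adjoint hphi.
(* By Yoneda and adjunction, [r psi] at [F] is the convergence to [psi] of the image of [F] under
   [f ∘ y]. Hence a right adjoint is determined by the values of its left adjoint on representables,
   where [f] and [precomp hphi] agree. *)
suff e : r = r'.
  by rewrite -e in a'; exact: (@adjoint_uniq (Pspace Y) (Pspace X) _ _ _ (@P_T0 X) a a').
apply/funext => psi; apply: sval_inj; apply/funext => F; apply/funext => -[].
rewrite -!yoneda_cvg -(@adjoint_cvg (Pspace Y) (Pspace X) _ _ _ _ a)
  -(@adjoint_cvg (Pspace Y) (Pspace X) _ _ _ _ a') !Umap_comp.
congr (cvg (Umap _ _) _); apply/funext => y; apply: sval_inj.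
by apply/funext => G; apply/funext => -[]; rewrite precomp_yoneda.
Qed.

Lemma precomp_adjoint_inv (X Y : space V) (phi : vrel V (U X) Y) (psi : vrel V (U Y) X)
  (hphi : is_module phi) (hpsi : is_module psi) :
  @adjoint V (P X) (P Y) (precomp hpsi) (precomp hphi) -> module_adjoint phi psi.
Proof.
move=> [_ _ u c]; split=> // F x.
  have /ple_P/(_ F tt) := u (yoneda x); rewrite /= -kleisliA.
  by have [_ /(congr1 (fun r => r F x))] := module_comp hpsi hphi => /= <-.
have /ple_P/(_ F tt) := c (yoneda x); rewrite /= -kleisliA.
by have [_ /(congr1 (fun r => r F x))] := module_comp hphi hpsi => /= <-.
Qed.

Lemma upper_star_map (X Y : space V) (h : X -> Y) : is_module (upper_star h) -> is_map h.
Proof.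
move=> [_ e] F x; rewrite -[cvg (Umap h F) (h x)]/(upper_star h (Umap h F) x) -e.
have -> : Umap h F = Umult (Umap (fun x => Uunit (h x)) F).
  by rewrite -(Umap_comp (@Uunit Y) h) Umult_map_unit.
apply: qle_trans (kleisli_ge _ _ _ F _); apply: qle_kten.
rewrite -{2}(Umap_id F); apply: Urel_map => z; exact: cvg_refl.
Qed.

Lemma lower_pre_full (X Y : space V) (f : P Y -> P X) : sober Y ->
  @has_adjoints V (Pspace Y) (Pspace X) f ->
  exists (h : X -> Y) (mh : is_map h), f = lower_pre mh.
Proof.
move=> sY [[g ag] [r ar]].
have [phi [hphi ef]] := left_adjoint_precomp ar.
(* The left adjoint [g] has the right adjoint [f], so it too is composition with a module. *)
have [phi' [hphi' eg]] := left_adjoint_precomp ag.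
have ma : module_adjoint phi phi'.
  by apply: (@precomp_adjoint_inv _ _ _ _ hphi hphi'); rewrite -ef -eg.
have ex x : exists y : Y, point_star x ∘ phi' = point_star y.
  have [|y [e _]] := sY _ (module_comp (point_star_module x) hphi'); last by exists y.
  by exists (phi ∘ @lower_star V (one V) X (fun=> x)); exact: point_adjoint.
pose h x := projT1 (cid (ex x)).
(* Sobriety was applied to each [x^* ∘ phi'] separately and gave a mere function [h]; its continuity
   is then read off from the module law of [h^*]. *)
have eh : phi' = upper_star h.
  apply/funext => F; apply/funext => x.
  rewrite -[RHS]/(point_star (h x) F tt) -(projT2 (cid (ex x))).
  apply: esym.
  by have [_ /(congr1 (fun r => r F x))] := hphi'.
have mh : is_map h by apply: upper_star_map; rewrite -eh.
exists h, mh.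
apply: (@adjoint_uniqr (Pspace X) (Pspace Y) g) ag _; first exact: P_T0.
suff -> : g = upper_pre mh by exact: upper_lower_adjoint.
by rewrite eg; apply/funext => psi; apply: sval_inj; rewrite /= eh.
Qed.

Lemma lower_pre_inj (X Y : space V) (h h' : X -> Y) (mh : is_map h) (mh' : is_map h') :
  T0 Y -> lower_pre mh = lower_pre mh' -> h = h'.
Proof.
move=> T0Y e; apply/funext => x.
have ce y : cvg (Uunit (h x)) y = cvg (Uunit (h' x)) y.
  rewrite -!Umap_unit -[LHS]/(sval (yoneda y) _ tt) -[RHS]/(sval (yoneda y) _ tt).
  by rewrite -(lower_preE mh) -(lower_preE mh') e.
by apply: T0Y; rewrite /ple; [rewrite ce|rewrite -ce]; exact: cvg_refl.
Qed.

(** * The presheaf functor: full, faithful and essentially surjective *)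

Definition P_ob (X : sober_space V) : ta_space V :=
  exist _ (Pspace (sval X)) (conj (@P_totally_algebraic _) (@P_T0 _)).

Lemma lower_pre_ta (X Y : space V) (h : X -> Y) (mh : is_map h) :
  @is_map V (Pspace Y) (Pspace X) (lower_pre mh) /\
  @has_adjoints V (Pspace Y) (Pspace X) (lower_pre mh).
Proof.
split; first exact: precomp_map.
split; last exact: precomp_left_adjoint.
by exists (upper_pre mh); exact: upper_lower_adjoint.
Qed.

Definition P_mor (X Y : opposite (Sober V)) (h : hom X Y) :
    @hom (TotAlg V) (P_ob X) (P_ob Y) :=
  exist _ (lower_pre (svalP h)) (lower_pre_ta (svalP h)).

Lemma P_mor1 X : P_mor (idm X) = @idm (TotAlg V) (P_ob X).
Proof.
apply: sval_inj; apply/funext => psi; apply: sval_inj.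
by apply/funext => F; apply/funext => -[]; rewrite [LHS]lower_preE [Umap _ F]Umap_id.
Qed.

Lemma P_morM (X Y Z : opposite (Sober V)) (g : hom Y Z) (f : hom X Y) :
  P_mor (cmp g f) = @cmp (TotAlg V) _ _ _ (P_mor g) (P_mor f).
Proof.
apply: sval_inj; apply/funext => psi; apply: sval_inj.
apply/funext => F; apply/funext => -[]; rewrite [LHS]lower_preE.
by rewrite [RHS]lower_preE [RHS]lower_preE Umap_comp.
Qed.

Definition P_functor : functor (opposite (Sober V)) (TotAlg V) := Functor P_mor1 P_morM.

Lemma inverse_adjoint (X Y : space V) (f : X -> Y) (g : Y -> X) : is_map f -> is_map g ->
  (forall x, g (f x) = x) -> (forall y, f (g y) = y) -> adjoint f g.
Proof.
by move=> mf mg gf fg; split=> // x; [rewrite gf|rewrite fg]; exact: cvg_refl.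
Qed.

Lemma P_functor_full (X Y : opposite (Sober V)) (f : hom (P_functor X) (P_functor Y)) :
  exists h : hom X Y, fmor P_functor h = f.
Proof.
have [_ af] := svalP f.
have [h [mh e]] := lower_pre_full (svalP X) af.
exists (exist _ h mh : hom X Y); apply: sval_inj; rewrite [RHS]e.
by congr lower_pre; exact: Prop_irrelevance.
Qed.

Lemma P_functor_faithful (X Y : opposite (Sober V)) (h h' : hom X Y) :
  fmor P_functor h = fmor P_functor h' -> h = h'.
Proof.
move=> /(congr1 sval) e; apply: sval_inj.
by apply: lower_pre_inj e; exact: sober_T0 (svalP X).
Qed.

Lemma P_functor_surj (L : TotAlg V) :
  exists (X : opposite (Sober V)) (f : hom (P_functor X) L), is_iso f.
Proof.
have [taL T0L] := svalP L; have [[Sup aS [t at_]] _] := taL.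
pose X : opposite (Sober V) := exist _ (core t) (core_sober T0L aS at_); exists X.
have rn x := realise_nerve T0L aS at_ x taL.
have nr := nerve_realise at_.
have mr := @realise_map _ _ t aS; have mn := @nerve_map _ t.
have a := @inverse_adjoint (Pspace (core t)) (sval L) _ _ mr mn nr rn.
have a' := @inverse_adjoint (sval L) (Pspace (core t)) _ _ mn mr rn nr.
have hr : @has_adjoints V (Pspace (core t)) (sval L) (realise Sup (t := t)).
  by split; [exists (nerve t)|exists (nerve t)].
have hn : @has_adjoints V (sval L) (Pspace (core t)) (nerve t).
  by split; [exists (realise Sup (t := t))|exists (realise Sup (t := t))].
pose r : @ta_hom V (P_functor X) L := exist _ (realise Sup (t := t)) (conj mr hr).
pose n : @ta_hom V L (P_functor X) := exist _ (nerve t) (conj mn hn).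
exists r, n.
by split; apply: sval_inj; apply/funext => x; [exact: nr|exact: rn].
Qed.

End Setting.

(** * The equivalence *)

Lemma full_faithful_surj_equivalent (C D : category) (F : functor C D) :
  (forall A B (g : hom (F A) (F B)), exists f : hom A B, fmor F f = g) ->
  (forall A B (f f' : hom A B), fmor F f = fmor F f' -> f = f') ->
  (forall B : D, exists (A : C) (f : hom (F A) B), is_iso f) ->
  equivalent C D.
Proof.
move=> full faithful surj.
pose o B := projT1 (cid (surj B)).
pose e B : hom (F (o B)) B := projT1 (cid (projT2 (cid (surj B)))).
have ie B : is_iso (e B) := projT2 (cid (projT2 (cid (surj B)))).
pose e' B : hom B (F (o B)) := projT1 (cid (ie B)).
have e'e B : cmp (e' B) (e B) = idm _ := (projT2 (cid (ie B))).1.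
have ee' B : cmp (e B) (e' B) = idm _ := (projT2 (cid (ie B))).2.
pose lift A B (g : hom (F A) (F B)) : hom A B := projT1 (cid (full A B g)).
have liftK A B (g : hom (F A) (F B)) : fmor F (lift A B g) = g := projT2 (cid (full A B g)).
(* The inverse functor conjugates by the chosen isomorphisms and lifts the result along [F]; its
   functor laws follow from faithfulness. *)
pose m A B (f : hom A B) := lift _ _ (cmp (e' B) (cmp f (e A))).
have m1 A : m A A (idm A) = idm (o A).
  by apply: faithful; rewrite liftK fmor1 cmp1m e'e.
have mM A B E (g : hom B E) (f : hom A B) : m _ _ (cmp g f) = cmp (m _ _ g) (m _ _ f).
  apply: faithful; rewrite fmorM !liftK -!cmpA; congr cmp; congr cmp.
  by rewrite [RHS]cmpA ee' cmp1m.
exists F, (Functor m1 mM); split.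
  exists (fun A => lift (o (F A)) A (e (F A))) => [A|A B f] /=.
    exists (lift A (o (F A)) (e' (F A))).
    by split; apply: faithful; rewrite fmorM !liftK fmor1.
  by apply: faithful; rewrite !fmorM !liftK cmpA ee' cmp1m.
exists e => [B|A B f] /=; first exact: ie.
by rewrite liftK cmpA ee' cmp1m.
Qed.

Lemma Sober_TotAlg_equivalent (V : vsetting) : ultra_setting V ->
  equivalent (opposite (Sober V)) (TotAlg V).
Proof.
move=> HV; apply: (full_faithful_surj_equivalent (F := P_functor HV)).
- exact: P_functor_full.
- exact: P_functor_faithful.
- exact: P_functor_surj.
Qed.

(** * The topological and the approach setting *)

Lemma xi_mono (V : quantale) T (W : U T) (f g : T -> V) : (forall t, f t ⊑ g t) ->
  xi (Umap f W) ⊑ xi (Umap g W).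
Proof.
move=> fg; apply: qinf_ge => _ [A /= WA <-].
apply: (@qle_trans _ (qsup (f @` (g @^-1` A)))).
  by apply: qinf_lb; exists (f @` (g @^-1` A)) => //; apply: US WA => t At; exists t.
by apply: qsup_le => _ [t At <-]; apply: qle_trans (fg t) _; exact: qsup_ub.
Qed.

Lemma bool_xiP (F : U bool) : xi (V := bool_quantale) F <-> ~ sval F [set false].
Proof.
split=> [x Ff|nF].
  have : @qle bool_quantale (xi (V := bool_quantale) F) (bool_sup [set false]).
    by apply: qinf_lb; exists [set false].
  by move=> /implyP/(_ x)/asboolP.
suff : @qle bool_quantale true (xi (V := bool_quantale) F) by [].
apply: qinf_ge => _ [A FA <-] /=; apply/asboolP; apply: contrapT => nA; apply: nF.
by apply: US FA => -[].
Qed.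

Lemma top_ultra : ultra_setting top_setting.
Proof.
split=> [[] w h|T W f g|F v w] //=.
- by apply: (implyP (h true _)) => // S /asboolP St; exists true.
- apply/implyP => h; apply/andP.
  split; [move: h; apply/implyP/(@xi_mono bool_quantale T W _ f)
    |move: h; apply/implyP/(@xi_mono bool_quantale T W _ g)] => t /=;
    by case: (f t) (g t) => -[].
- split=> [|h]; last first.
    apply/implyP => wt; apply/asboolP => vf; apply: contrapT => /bool_xiP xF.
    by have := implyP h (introT andP (conj wt xF)); rewrite vf.
  case: w => //= /asboolP h; apply/implyP => /bool_xiP nF.
  by case: v h => // /(_ erefl).
Qed.

Section ApproachSetting.
Variable R : realType.
Local Open Scope ereal_scope.

(** In the reversed order [qinf] is the numerical infimum of the nonnegative upper bounds.
    Nonnegativity of [enn_xi F] makes it one of these bounds. *)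
Lemma enn_xiE (F : U (enn R)) : sval (xi (V := app_setting R) F) = enn_xi F.
Proof.
apply/eqP; rewrite eq_le; apply/andP; split.
  have x0 : 0 <= enn_xi F.
    apply: (le_trans (enn_inf_ge0 (setT : set (enn R)))); apply: ereal_sup_ubound.
    by exists setT => //; exact: UT.
  apply: ereal_inf_lbound; exists (exist (fun x => 0 <= x) _ x0) => // _ [A FA <-] /=.
  by apply: ereal_sup_ubound; exists A.
apply: le_ereal_inf_tmp => _ [v hv <-]; apply: ge_ereal_sup => _ [A FA <-].
exact: (hv (enn_sup A) (ex_intro2 _ _ A FA erefl)).
Qed.

(** For finite [c], nonnegativity and nonemptiness make all elements and both suprema finite, so
    each summand can be moved across the inequality. *)
Lemma ereal_supD_le (A B : set (\bar R)) (c : \bar R) :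
  (forall a, A a -> 0 <= a) -> (forall b, B b -> 0 <= b) -> A !=set0 -> B !=set0 ->
  (forall a b, A a -> B b -> a + b <= c) -> ereal_sup A + ereal_sup B <= c.
Proof.
move=> A0 B0 [a Aa] [b Bb] h.
case: c h => [c|_|h]; [|exact: leey|]; last first.
  by have := le_trans (adde_ge0 (A0 _ Aa) (B0 _ Bb)) (h _ _ Aa Bb).
move=> h.
have fB b' : B b' -> b' \is a fin_num.
  move=> Bb'; rewrite ge0_fin_numE ?B0 //; apply: le_lt_trans (ltry c).
  by apply: le_trans (h _ _ Aa Bb'); rewrite leeDr // A0.
have sA b' : B b' -> ereal_sup A <= c%:E - b'.
  by move=> Bb'; apply: ge_ereal_sup => a' Aa'; rewrite leeBrDr ?fB //; exact: h.
have fA : ereal_sup A \is a fin_num.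
  rewrite ge0_fin_numE; last by apply: le_trans (A0 _ Aa) _; exact: ereal_sup_ubound.
  apply: le_lt_trans (sA _ Bb) _; have := fB _ Bb; case: (b) => // r _.
  by rewrite -EFinB ltry.
rewrite addeC -leeBrDr //; apply: ge_ereal_sup => b' Bb'.
by rewrite leeBrDr // addeC -leeBrDr ?fB //; exact: sA.
Qed.

Lemma app_ultra : ultra_setting (app_setting R).
Proof.
pose X := xi (V := app_setting R).
split=> [v w h|T W f g|F v w].
- case: v h => -[v| |] v0 h //=; [|exact: leey].
  (* For finite [v] and [e > 0], [v + e] is totally below [v]: an infimum at most [v] is approached
     by an element below [v + e]. *)
  apply/lee_addgt0Pr => e e0.
  have ve0 : 0 <= v%:E + e%:E by rewrite adde_ge0 // lee_fin ltW.
  apply: (h (exist (fun x => 0 <= x) _ ve0)) => S /= Sv.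
  have [|_ [s Ss <-] sv] := @ereal_inf_lt _ [set sval u | u in S] (v%:E + e%:E).
    by apply: le_lt_trans Sv _; rewrite lte_fin ltrDl.
  by exists s => //; exact: ltW.
- rewrite -[qle _ _]/(is_true (sval (X (Umap f W)) + sval (X (Umap g W)) <=
    sval (X (Umap (fun t => enn_add (f t) (g t)) W)))) !enn_xiE; apply: ereal_supD_le.
  + by move=> _ [A _ <-]; exact: enn_inf_ge0.
  + by move=> _ [A _ <-]; exact: enn_inf_ge0.
  + by exists (enn_inf setT), setT => //; exact: UT.
  + by exists (enn_inf setT), setT => //; exact: UT.
  move=> _ _ [A /= WA <-] [B /= WB <-].
  pose C := (fun t => enn_add (f t) (g t)) @` (f @^-1` A `&` g @^-1` B).
  apply: (@le_trans _ _ (enn_inf C)); last first.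
    by apply: ereal_sup_ubound; exists C => //; apply: US (UI WA WB) => t At; exists t.
  apply: le_ereal_inf_tmp => _ [_ [t [At Bt] <-] <-] /=.
  by apply: leeD; apply: ereal_inf_lbound; [exists (f t)|exists (g t)].
- rewrite -[_ <-> _]/(maxe (sval v - enn_xi F) 0 <= sval w <->
    sval v <= sval w + sval (X F)) enn_xiE ge_max (svalP w) andbT.
  have x0 : 0 <= enn_xi F by rewrite -enn_xiE; exact: (svalP (X F)).
  case: (enn_xi F) x0 => [x| |] // x0; first by rewrite leeBlDr.
  (* The case of an infinite limit: the difference is [-oo], and [w + oo] bounds every [v], so both
     sides hold. *)
  by rewrite addeNy leNye addey ?leey // gt_eqF // (lt_le_trans _ (svalP w)).
Qed.

End ApproachSetting.

Theorem theorem6p5 (R : realType) :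
  equivalent (opposite Sob) TATop /\ equivalent (opposite (ASob R)) (TAApp R).
Proof.
split; apply: Sober_TotAlg_equivalent; [exact: top_ultra|exact: app_ultra].
Qed.
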